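(* Let $D$ be the degree sequence of a tree. Among all trees with degree sequence $D$, the incidence energy, or equivalently the Laplacian-energy-like invariant, is minimised by the greedy tree: for every tree $T$ with degree sequence $D$, $\mathrm{IE}(T)\ge \mathrm{IE}(\mathcal G(D))$ and $\mathrm{LEL}(T)\ge \mathrm{LEL}(\mathcal G(D))$.
   Context: The incidence energy $\mathrm{IE}(G)$ of a graph $G$ is the sum of the singular values of its (0/1, unsigned) vertex-edge incidence matrix. The Laplacian-energy-like invariant is $\mathrm{LEL}(T)=\sum_{i=1}^n\sqrt{\mu_i}$, where $\mu_1,\dots,\mu_n$ are the eigenvalues of the Laplacian matrix of $T$ (diagonal degree matrix minus adjacency matrix). For trees, $\mathrm{IE}(T)=\mathrm{LEL}(T)$. Degree sequences are written in non-increasing order. Greedy tree $\mathcal G(D)$: start with a root $v$ that is assigned the largest degree in $D$. Give $v$ its neighbours $v_1,\dots,v_{d(v)}$ and assign to them the largest available degrees with $d(v_1)\ge d(v_2)\ge\cdots$. Then give $v_1$ its remaining neighbours and assign to them the largest available degrees in non-increasing order; then do the same for $v_2$, $v_3$, etc. Continue in this way, always continuing with the labelled vertex of largest degree whose neighbours are not yet labelled (equivalently, process vertices in breadth-first order, in the order in which they were labelled, always assigning the largest remaining degrees). *)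

(* Defs.v *)
From mathcomp Require Import all_boot all_order all_algebra.
From mathcomp Require Import reals.
From mathcomp Require Import polyrcf.

Set Implicit Arguments.
Unset Strict Implicit.
Unset Printing Implicit Defensive.

Import Order.TTheory GRing.Theory Num.Theory.
Local Open Scope ring_scope.

Section Graphs.
Variables (T : finType) (e : rel T).

Definition simple_graph : Prop := symmetric e /\ irreflexive e.

(* [ucycle e c] also holds for c = [:: x; y] with x and y adjacent, so only
   the cycles through at least three vertices are excluded. *)
Definition acyclic : Prop := forall c : seq T, (2 < size c)%N -> ~ ucycle e c.

Definition is_tree : Prop :=
  [/\ simple_graph, (0 < #|T|)%N, (forall x y : T, connect e x y) & acyclic].

Definition degree (x : T) : nat := #|[set y | e x y]|.

Definition degree_sequence : seq nat := sort geq [seq degree x | x <- enum T].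

Definition edge_set : {set {set T}} :=
  [set A : {set T} | [exists x, exists y, e x y && (A == [set x; y])]].

Variable R : realType.

Definition incidence_mx : 'M[R]_(#|T|, #|edge_set|) :=
  \matrix_(i, j) ((enum_val i : T) \in (enum_val j : {set T}))%:R.

Definition degree_mx : 'M[R]_#|T| :=
  diag_mx (\row_i (degree (enum_val i))%:R).

Definition adjacency_mx : 'M[R]_#|T| :=
  \matrix_(i, j) (e (enum_val i) (enum_val j))%:R.

Definition laplacian_mx : 'M[R]_#|T| := degree_mx - adjacency_mx.

End Graphs.

Arguments incidence_mx {T} e R.
Arguments degree_mx {T} e R.
Arguments adjacency_mx {T} e R.
Arguments laplacian_mx {T} e R.

Section Spectra.
Variable R : realType.

(* The real eigenvalues, repeated according to their algebraic multiplicity.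
   For a symmetric matrix, the only case used below, these are all n
   eigenvalues. *)
Definition eigenvalues n (A : 'M[R]_n) : seq R :=
  let p := char_poly A in flatten [seq nseq (mup x p) x | x <- rootsR p].

(* For m > n this lists m - n extra zeros compared with the convention of
   min(m, n) singular values; they do not contribute to sums. *)
Definition singular_values m n (M : 'M[R]_(m, n)) : seq R :=
  [seq Num.sqrt x | x <- eigenvalues (M *m M^T)].

End Spectra.

Definition incidence_energy (R : realType) (T : finType) (e : rel T) : R :=
  \sum_(s <- singular_values (incidence_mx e R)) s.

Definition laplacian_energy_like (R : realType) (T : finType) (e : rel T) : R :=
  \sum_(mu <- eigenvalues (laplacian_mx e R)) Num.sqrt mu.

(* Greedy construction.  Vertices are named 0, 1, 2, ... in the order in which
   they are labelled.  [queue] holds, in that order, the labelled vertices whose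
   neighbours are not yet all labelled, each with the number of neighbours it
   still lacks; [next] is the first unused name and [avail] the non-increasing
   list of degrees not yet assigned.  Since degrees are assigned in
   non-increasing order, the head of [queue] is always a vertex of largest
   degree in it.  Each of the first [fuel] vertices is processed once; the
   result lists the pairs (parent, child). *)
Fixpoint greedy_arcs (fuel : nat) (queue : seq (nat * nat)) (next : nat)
    (avail : seq nat) : seq (nat * nat) :=
  match fuel, queue with
  | fuel'.+1, (v, c) :: queue' =>
      let children := iota next c in
      let degrees := take c avail in
      [seq (v, w) | w <- children] ++
      greedy_arcs fuel' (queue' ++ zip children [seq d.-1 | d <- degrees])
        (next + c)%N (drop c avail)
  | _, _ => [::]
  end.

(* [D] is meant to be non-increasing; only the root is not already adjacent to
   a parent, hence it lacks [head 0 D] neighbours while a later vertex of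
   degree d lacks d - 1. *)
Definition greedy_tree (D : seq nat) : rel 'I_(size D) :=
  let arcs := greedy_arcs (size D) [:: (0%N, head 0%N D)] 1%N (behead D) in
  fun i j => ((i : nat, j : nat) \in arcs) || ((j : nat, i : nat) \in arcs).
Arguments greedy_tree D : clear implicits.

(* Main.v *)
Require Import Defs.
From mathcomp Require Import perm.
From mathcomp Require Import all_boot all_order all_algebra.
From mathcomp Require Import reals.
From mathcomp Require Import complex polyrcf boolp.
From mathcomp.analysis Require Import sequences exp.
From mathcomp Require Import ring lra zify.

(**
For a tree both energies equal the sum of the square roots of the Laplacian
eigenvalues [mu_i], because the signless Laplacian of a bipartite graph is
conjugate to its Laplacian.  As sqrt(mu) is, up to a constant, the integral of
[x^(-3/2) ln (1 + x mu)] over [x > 0], it suffices that the greedy tree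
minimises [det (I + x L)] for every [x > 0]; a geometric Riemann sum replaces
the integral.

Eliminating the vertices of a rooted tree from the leaves upwards gives each
branch [t] the effective conductance to ground [s t = 1 + sum y (s t')], where
[t'] ranges over the child branches and [y s = x s / (s + x)], and the
determinant is the product of the pivots [s t + x] times the conductance of the
whole tree at its root.  If [S_v] and [S_w] are the sums of [y] over the
branches at [v] pointing away from [w] and conversely, the determinant is
bilinear in [(S_v, S_w)] with a nonnegative mixed coefficient, hence concave
when branches are redistributed between [v] and [w]: one may let one of the two
vertices carry only the smallest branches.  Thus some optimal tree has an
internal vertex of smallest degree whose neighbours, but one, are the leaves of
smallest conductance.  Collapsing it into a new leaf and iterating is
Huffman's algorithm, and as the new leaves are never smaller than the existing
ones its priority queue is a plain queue: it builds the greedy tree in reverse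
breadth-first order.
*)

Set Implicit Arguments.
Unset Strict Implicit.
Unset Printing Implicit Defensive.

Import Order.TTheory GRing.Theory Num.Theory.
Local Open Scope ring_scope.

(** * Rooted trees with collapsed branches and the exchange argument *)

(* With [th] the largest value on [B], both sides compare to the sum of
   [min (f i - th) 0] over all of [B ++ C]. *)
Lemma sum_smallest (R : realFieldType) (I : eqType) (f : I -> R)
    (B C X X' : seq I) :
  perm_eq (X ++ X') (B ++ C) -> (size B <= size X)%N ->
  {in B ++ C, forall i, 0 <= f i} ->
  {in B & C, forall i j, f i <= f j} ->
  \sum_(i <- B) f i <= \sum_(i <- X) f i.
Proof.
move=> pXB sBX f0 fBC.
pose th := \big[Num.max/0]_(i <- B) f i.
have th0 : 0 <= th by rewrite /th; elim/big_rec: _ => // i z _ z0; rewrite le_max z0 orbT.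
have Bth : {in B, forall i, f i <= th}.
  by move=> i iB; rewrite /th; exact: (@le_bigmax_seq _ R _ B 0 i predT f iB isT).
have thC : {in C, forall j, th <= f j}.
  move=> j jC; rewrite /th big_seq; elim/big_ind: _ => //.
  - by apply: f0; rewrite mem_cat jC orbT.
  - by move=> u v hu hv; rewrite ge_max hu hv.
  - by move=> i iB; exact: fBC.
pose g i := Num.min (f i - th) 0.
have hB : \sum_(i <- B ++ C) g i = \sum_(i <- B) f i - th *+ size B.
  rewrite big_cat /= [\sum_(i <- C) g i]big1_seq ?addr0; last first.
    by move=> j jC; apply: min_r; rewrite subr_ge0 thC.
  rewrite (_ : \sum_(i <- B) g i = \sum_(i <- B) (f i - th)); last first.
    apply: eq_big_seq => i iB; apply: min_l; rewrite subr_le0; exact: Bth.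
  by rewrite big_split /= sumrN; congr (_ - _);
    rewrite big_const_seq count_predT iter_addr_0.
have hX : \sum_(i <- X) f i = \sum_(i <- X) (f i - th) + th *+ size X.
  by rewrite big_split /= sumrN big_const_seq count_predT iter_addr_0 subrK.
have h1 : \sum_(i <- X) g i <= \sum_(i <- X) (f i - th).
  by apply: ler_sum => i _; rewrite ge_min lexx.
have h2 : \sum_(i <- X ++ X') g i <= \sum_(i <- X) g i.
  rewrite big_cat /= gerDl; apply: sumr_le0 => i _; by rewrite ge_min lexx orbT.
have h3 : th *+ size B <= th *+ size X by apply: ler_wpMn2l.
move: h2; rewrite (perm_big _ pXB) hB hX => h2; lra.
Qed.

Section Rose.
Variables (R : realFieldType) (x : R).
Hypothesis x_gt0 : 0 < x.

Notation tr := (GenTree.tree R).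
Notation Lf := (@GenTree.Leaf R).
Notation Nd := (@GenTree.Node R 0).

Lemma tree_seq_ind (K : tr -> Prop) :
  (forall l, K (Lf l)) ->
  (forall n ts, {in ts, forall t, K t} -> K (GenTree.Node n ts)) ->
  forall t, K t.
Proof.
move=> KL KN; elim=> // n ts IH; apply: KN.
elim: ts IH => [|t ts IHts] //= [Kt Kts] u; rewrite in_cons => /orP[/eqP->//|].
exact: IHts.
Qed.

(* Conductance to ground of a branch [z] seen through an edge of conductance [x]. *)
Definition cond (z : R) := x * z / (z + x).

(* The label of [Node] is irrelevant; [Leaf l] stands for a branch already
   collapsed to conductance [l], an actual leaf having [l = 1]. *)
Fixpoint ground (t : tr) : R :=
  match t with
  | GenTree.Leaf l => l
  | GenTree.Node _ ts => 1 + \sum_(z <- map ground ts) cond z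
  end.

Fixpoint pivots (t : tr) : R :=
  match t with
  | GenTree.Leaf l => l + x
  | GenTree.Node _ ts =>
      (1 + \sum_(z <- map ground ts) cond z + x) * \prod_(z <- map pivots ts) z
  end.

Fixpoint arities (t : tr) : seq nat :=
  match t with
  | GenTree.Leaf _ => [::]
  | GenTree.Node _ ts => size ts :: flatten (map arities ts)
  end.

Fixpoint leaves (t : tr) : seq R :=
  match t with
  | GenTree.Leaf l => [:: l]
  | GenTree.Node _ ts => flatten (map leaves ts)
  end.

Definition cond_sum (Z : seq tr) := \sum_(t <- Z) cond (ground t).
Definition pivots_prod (Z : seq tr) := \prod_(t <- Z) pivots t.
(* From here on an unrooted tree is given by a vertex, listing the branches [Z]
   at it; an arity is a degree minus one. *)
Definition tree_det Z := pivots_prod Z * (1 + cond_sum Z).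
Definition all_arities (Z : seq tr) := flatten (map arities Z).
Definition all_leaves (Z : seq tr) := flatten (map leaves Z).
Definition tree_arities Z := (size Z).-1 :: all_arities Z.
Definition nneg (s : seq R) := all (fun l => 0 <= l) s.

Lemma ground_Node n ts : ground (GenTree.Node n ts) = 1 + cond_sum ts.
Proof. by rewrite /= big_map. Qed.

Lemma pivots_Node n ts : pivots (GenTree.Node n ts) =
  (1 + cond_sum ts + x) * pivots_prod ts.
Proof. by rewrite /= !big_map. Qed.

Lemma leaves_Node n ts : leaves (GenTree.Node n ts) = all_leaves ts. Proof. by []. Qed.
Lemma arities_Node n ts : arities (GenTree.Node n ts) =
  size ts :: all_arities ts. Proof. by []. Qed.

Lemma cond_sum_cons t Z : cond_sum (t :: Z) = cond (ground t) + cond_sum Z.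
Proof. by rewrite /cond_sum big_cons. Qed.
Lemma pivots_prod_cons t Z : pivots_prod (t :: Z) = pivots t * pivots_prod Z.
Proof. by rewrite /pivots_prod big_cons. Qed.
Lemma all_arities_cons t Z : all_arities (t :: Z) =
  arities t ++ all_arities Z. Proof. by []. Qed.
Lemma all_leaves_cons t Z : all_leaves (t :: Z) =
  leaves t ++ all_leaves Z. Proof. by []. Qed.
Lemma cond_sum_cat Y Z : cond_sum (Y ++ Z) = cond_sum Y + cond_sum Z.
Proof. by rewrite /cond_sum big_cat. Qed.
Lemma pivots_prod_cat Y Z : pivots_prod (Y ++ Z) = pivots_prod Y * pivots_prod Z.
Proof. by rewrite /pivots_prod big_cat. Qed.
Lemma all_arities_cat Y Z : all_arities (Y ++ Z) = all_arities Y ++ all_arities Z.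
Proof. by rewrite /all_arities map_cat flatten_cat. Qed.
Lemma all_leaves_cat Y Z : all_leaves (Y ++ Z) = all_leaves Y ++ all_leaves Z.
Proof. by rewrite /all_leaves map_cat flatten_cat. Qed.

Lemma cond_ge0 z : 0 <= z -> 0 <= cond z.
Proof. by move=> z0; rewrite /cond divr_ge0 ?mulr_ge0 ?addr_ge0 // ltW. Qed.

Lemma cond_le z z' : 0 <= z -> z <= z' -> cond z <= cond z'.
Proof.
move=> z0 zz'; have z'0 := le_trans z0 zz'.
(* In this form [w] occurs only in a denominator, which makes the monotonicity visible. *)
have h (w : R) : 0 <= w -> cond w = x - x ^+ 2 / (w + x).
  by move=> w0; rewrite /cond; field; rewrite gt_eqF // ltr_wpDl.
rewrite !h // lerD2l lerN2 ler_pM2l ?exprn_gt0 // lef_pV2 ?posrE ?ltr_wpDl //.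
by rewrite lerD2r.
Qed.

Lemma cond_sum_ge0 Z : {in Z, forall t, 0 <= ground t} -> 0 <= cond_sum Z.
Proof.
by move=> h; rewrite /cond_sum big_seq; apply: sumr_ge0 => t tZ; apply/cond_ge0/h.
Qed.

Lemma nneg_all_leaves Z t : nneg (all_leaves Z) -> t \in Z -> nneg (leaves t).
Proof.
move=> /allP h tZ; apply/allP => l lt; apply: h; apply/flattenP.
by exists (leaves t) => //; apply: map_f.
Qed.

Lemma ground_ge0 t : nneg (leaves t) -> 0 <= ground t.
Proof.
elim/tree_seq_ind: t => [l|n ts IH] /=; first by rewrite andbT.
move=> h; rewrite big_map addr_ge0 // cond_sum_ge0 // => t tts.
by apply: IH => //; exact: nneg_all_leaves h tts.
Qed.

Lemma cond_sum_nneg_ge0 Z : nneg (all_leaves Z) -> 0 <= cond_sum Z.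
Proof. by move=> h; apply: cond_sum_ge0 => t tZ; apply: ground_ge0;
  exact: nneg_all_leaves h tZ. Qed.

Lemma pivots_gt0 t : nneg (leaves t) -> 0 < pivots t.
Proof.
elim/tree_seq_ind: t => [l|n ts IH] /=; first by rewrite andbT => l0; rewrite ltr_wpDl.
move=> h; have y0 := cond_sum_nneg_ge0 h; rewrite !big_map mulr_gt0 //.
  by rewrite ltr_wpDl // addr_ge0.
rewrite big_seq; apply: prodr_gt0 => t tts.
by apply: IH => //; exact: nneg_all_leaves h tts.
Qed.

Lemma pivots_prod_gt0 Z : nneg (all_leaves Z) -> 0 < pivots_prod Z.
Proof.
move=> h; rewrite /pivots_prod big_seq; apply: prodr_gt0 => t tZ; apply: pivots_gt0.
exact: nneg_all_leaves h tZ.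
Qed.

Lemma nneg_cat s1 s2 : nneg (s1 ++ s2) = nneg s1 && nneg s2.
Proof. exact: all_cat. Qed.
Lemma perm_nneg s1 s2 : perm_eq s1 s2 -> nneg s1 = nneg s2.
Proof. exact: perm_all. Qed.

(** Instead of an isomorphism, only the invariants that the optimisation uses are recorded.
    Nonnegative leaves keep the denominators in the determinant nonzero. *)
Definition same_tree Z Z' :=
  [/\ perm_eq (tree_arities Z) (tree_arities Z'), perm_eq (all_leaves Z) (all_leaves Z') &
      nneg (all_leaves Z) -> tree_det Z = tree_det Z'].

Lemma same_tree_trans Z2 Z1 Z3 : same_tree Z1 Z2 -> same_tree Z2 Z3 -> same_tree Z1 Z3.
Proof.
move=> [a1 b1 c1] [a2 b2 c2]; split.
- exact: perm_trans a1 a2.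
- exact: perm_trans b1 b2.
- by move=> h; rewrite c1 // c2 // -(perm_nneg b1).
Qed.

Lemma perm_same_tree Z Z' : perm_eq Z Z' -> same_tree Z Z'.
Proof.
move=> h; split.
- by rewrite /tree_arities (perm_size h) perm_cons; apply/perm_flatten/perm_map.
- by apply/perm_flatten/perm_map.
- by move=> _; rewrite /tree_det /pivots_prod /cond_sum !(perm_big _ h).
Qed.

(* Moves the root along an edge. *)
Lemma reroot n us ts : same_tree (GenTree.Node n us :: ts) (Nd ts :: us).
Proof.
split.
- rewrite /tree_arities !all_arities_cons !arities_Node /=; apply/permP => p /=.
  by rewrite !count_cat; lia.
- by rewrite !all_leaves_cons !leaves_Node perm_catC.
- rewrite all_leaves_cons nneg_cat leaves_Node =>
  /andP[/cond_sum_nneg_ge0 hu /cond_sum_nneg_ge0 ht].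
  rewrite /tree_det !pivots_prod_cons !cond_sum_cons !pivots_Node !ground_Node /cond.
  by field; move: x_gt0 => x0; rewrite !gt_eqF //; lra.
Qed.

(* The branch holding [v] at its end; [c] lists, upwards from [v], the other
   child branches at the vertices on the path. *)
Fixpoint plug (c : seq (seq tr)) (v : tr) : tr :=
  if c is ts :: c' then plug c' (Nd (v :: ts)) else v.

Lemma plug_node c ts : exists us, plug c (Nd ts) = Nd us.
Proof. by elim: c ts => [|us c IH] ts /=; [exists ts|apply: IH]. Qed.

(** Reroots along the path down to its end. [Y'] is found before [v], so one surrounding serves
    every branch put in place of [v]. *)
Lemma unplug c Y : exists Y', forall v, same_tree (plug c v :: Y) (v :: Y').
Proof.
elim: c => [|ts c [Y' h]] /=; first by exists Y.
exists (Nd Y' :: ts) => v; apply: same_tree_trans (h _) _.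
apply: same_tree_trans (reroot _ _ _) _; apply: perm_same_tree.
by rewrite -[Nd Y' :: v :: ts]/([:: Nd Y'; v] ++ ts) (perm_catCA [:: Nd Y'] [:: v]).
Qed.

Lemma plug_arities c : exists a, forall v, perm_eq (arities (plug c v)) (arities v ++ a).
Proof.
elim: c => [|ts c [a h]] /=; first by exists [::] => v; rewrite cats0.
exists ((size ts).+1 :: all_arities ts ++ a) => v; apply: perm_trans (h _) _.
rewrite arities_Node all_arities_cons /=; apply/permP => p /=;
  rewrite !count_cat /= !count_cat; lia.
Qed.

Lemma plug_leaves c : exists a, forall v, perm_eq (leaves (plug c v)) (leaves v ++ a).
Proof.
elim: c => [|ts c [a h]] /=; first by exists [::] => v; rewrite cats0.
exists (all_leaves ts ++ a) => v; apply: perm_trans (h _) _.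
by rewrite leaves_Node all_leaves_cons catA.
Qed.

Fixpoint occurs (good : pred (seq tr)) (t : tr) : bool :=
  match t with
  | GenTree.Leaf _ => false
  | GenTree.Node _ ts => good ts || has (occurs good) ts
  end.

(** Walks from the vertex carrying [v] to one with a [good] list, rerooting along each edge; the
    lists passed on the way, without the next vertex of the path, become the layers of [c]. *)
Lemma path_to (good : pred (seq tr)) n Y : occurs good (GenTree.Node n Y) ->
  exists c Y', good Y' /\ forall v, same_tree (v :: Y) (plug c v :: Y').
Proof.
move: {2}(GenTree.Node n Y) (erefl (GenTree.Node n Y)) => t.
elim/tree_seq_ind: t n Y => // n ts IH m Y [-> ->] {m Y} /=.
have [gts _|_ /= /hasP[t tts ot]] := boolP (good ts); first by exists [::], ts.
case: t tts ot IH => // m us tts ot IH.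
have [c [Y' [gY' h]]] := IH _ tts m us erefl ot.
exists (rem (GenTree.Node m us) ts :: c), Y'; split=> // v /=.
apply: same_tree_trans (h _).
apply: same_tree_trans (perm_same_tree _) (reroot m us _).
by apply/permP => p /=; rewrite (permP (perm_to_rem tts) p) /= addnCA.
Qed.

(** The end vertices have arities [size X] and [size Y]; as the total is fixed, either size
    condition keeps this pair up to order. *)
Lemma plug_arities_perm c X Y X' Y' :
  perm_eq (X ++ Y) (X' ++ Y') -> size X' = size X \/ size X' = size Y ->
  perm_eq (tree_arities (plug c (Nd X) :: Y)) (tree_arities (plug c (Nd X') :: Y')).
Proof.
move=> h hs; have [a ha] := plug_arities c.
have hsz := perm_size h; rewrite !size_cat in hsz.
have /permP har : perm_eq (all_arities (X ++ Y)) (all_arities (X' ++ Y')).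
  by apply/perm_flatten/perm_map.
apply/permP => p; move: (har p);
  rewrite /tree_arities !all_arities_cons !all_arities_cat /= !count_cat.
rewrite !(permP (ha _)) !count_cat !arities_Node /=.
move=> e; set m := count p a.
have e' k l : (k + (l + count p (all_arities X) + m + count p (all_arities Y)) =
   k + (l + count p (all_arities X') + m + count p (all_arities Y')))%N.
  by rewrite -!addnA ![(m + _)%N]addnC !addnA -!(addnA (k + l)) e.
case: hs => hs; rewrite hs in hsz *.
  by move/addnI: hsz => ->.
by move: hsz; rewrite addnC => /addnI <-; rewrite e' !addnA [(p (size Y) + _)%N]addnC.
Qed.

Lemma plug_leaves_perm c X Y X' Y' : perm_eq (X ++ Y) (X' ++ Y') ->
  perm_eq (all_leaves (plug c (Nd X) :: Y)) (all_leaves (plug c (Nd X') :: Y')).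
Proof.
move=> h; have [a ha] := plug_leaves c.
have /permP har : perm_eq (all_leaves (X ++ Y)) (all_leaves (X' ++ Y')).
  by apply/perm_flatten/perm_map.
apply/permP => p; move: (har p); rewrite !all_leaves_cons !all_leaves_cat !count_cat.
by rewrite !(permP (ha _)) !count_cat !leaves_Node; lia.
Qed.

(* [(ground t * below t, below t)] are the determinants with the root of [t] kept,
   respectively deleted; along a path they transform linearly. *)
Definition below t := pivots t / (ground t + x).

Lemma below_Node n ts : nneg (all_leaves ts) -> below (GenTree.Node n ts) = pivots_prod ts.
Proof.
move=> /cond_sum_nneg_ge0 h; rewrite /below pivots_Node ground_Node; field.
by move: x_gt0 => x0; rewrite gt_eqF //; lra.
Qed.

Lemma pivots_below t : nneg (leaves t) -> pivots t = (ground t + x) * below t.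
Proof.
move=> /ground_ge0 h; rewrite /below mulrC divfK //.
by move: x_gt0 => x0; rewrite gt_eqF //; lra.
Qed.

Lemma nneg_plug c v : nneg (leaves (plug c v)) -> nneg (leaves v).
Proof.
by have [a /(_ v) ha] := plug_leaves c; rewrite (perm_nneg ha) nneg_cat => /andP[].
Qed.

(** A path acts as a two-port: each layer multiplies the pair by a 2 by 2 matrix with nonnegative
    entries, and [k] holds the rows of the product. Through [v0] the side branches are known to have
    nonnegative leaves. *)
Lemma plug_linear c v0 : nneg (leaves (plug c v0)) ->
  exists k : R * R * (R * R), [/\ 0 <= k.1.1 /\ 0 <= k.1.2, 0 <= k.2.1 /\ 0 <= k.2.2 &
    forall v, nneg (leaves v) ->
      ground (plug c v) * below (plug c v) = (k.1.1 * ground v + k.1.2) * below v /\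
      below (plug c v) = (k.2.1 * ground v + k.2.2) * below v].
Proof.
elim: c v0 => [|ts c IH] v0 /= h.
  exists ((1, 0), (0, 1)); split=> //= v _.
  by rewrite !mul1r mul0r addr0 add0r mul1r.
have := nneg_plug h; rewrite leaves_Node all_leaves_cons nneg_cat => /andP[_ nts].
have [[[k1 k2] [k3 k4]] /= [[k10 k20] [k30 k40] H]] := IH _ h.
have yts := cond_sum_nneg_ge0 nts; have Pts := pivots_prod_gt0 nts.
exists ((pivots_prod ts * (k1 * (1 + cond_sum ts + x) + k2),
  pivots_prod ts * (k1 * ((1 + cond_sum ts) * x) + k2 * x)),
        (pivots_prod ts * (k3 * (1 + cond_sum ts + x) + k4),
          pivots_prod ts * (k3 * ((1 + cond_sum ts) * x) + k4 * x))).
have x0 := x_gt0; split=> /= [||v nv].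
- by split; rewrite mulr_ge0 ?addr_ge0 ?mulr_ge0 ?addr_ge0 // ltW.
- by split; rewrite mulr_ge0 ?addr_ge0 ?mulr_ge0 ?addr_ge0 // ltW.
have nN : nneg (all_leaves (v :: ts)) by rewrite all_leaves_cons nneg_cat nv.
have [-> ->] := H (Nd (v :: ts)) nN.
have sv0 := ground_ge0 nv.
rewrite !ground_Node !below_Node // pivots_prod_cons cond_sum_cons (pivots_below nv) /cond.
by split; field; rewrite gt_eqF //; lra.
Qed.

(* The determinant is concave on the segment of constant total [cond_sum], so one
   of the two end points, [B] at the lower vertex or [B] at the root, is no worse. *)
Lemma exchange c Yv Yw B C :
  nneg (all_leaves (plug c (Nd Yv) :: Yw)) -> perm_eq (Yv ++ Yw) (B ++ C) ->
  cond_sum B <= cond_sum Yv -> cond_sum B <= cond_sum Yw ->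
  tree_det (plug c (Nd B) :: C) <= tree_det (plug c (Nd Yv) :: Yw) \/
  tree_det (plug c (Nd C) :: B) <= tree_det (plug c (Nd Yv) :: Yw).
Proof.
move=> nn pYB hBv hBw.
have nn1 := nn; rewrite all_leaves_cons nneg_cat in nn1; case/andP: nn1 => np nYw.
have nYv : nneg (all_leaves Yv) by have := nneg_plug np.
have nYY : nneg (all_leaves (Yv ++ Yw)) by rewrite all_leaves_cat nneg_cat nYv.
have nBC : nneg (all_leaves (B ++ C)).
  by rewrite (perm_nneg (_ : perm_eq _ (all_leaves (Yv ++ Yw)))) // perm_sym;
    apply/perm_flatten/perm_map.
have nB : nneg (all_leaves B) by move: nBC; rewrite all_leaves_cat nneg_cat => /andP[].
have nC : nneg (all_leaves C) by move: nBC; rewrite all_leaves_cat nneg_cat => /andP[].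
have x0 := x_gt0.
have [[[k1 k2] [k3 k4]] /= [[k10 k20] [k30 k40] H]] := plug_linear np.
(* The bilinear form: apart from the product of pivots, the determinant is affine in each of
   [cond_sum X] and [cond_sum Y], with mixed coefficient [k1 + x * k3]. *)
have FE X Y : nneg (all_leaves X) -> nneg (all_leaves Y) -> tree_det (plug c (Nd X) :: Y) =
    pivots_prod X * pivots_prod Y * (((k1 + x * k3) * (1 + cond_sum X) + (k2 +
      x * k4)) * (1 + cond_sum Y)
                   + x * (k1 * (1 + cond_sum X) + k2)).
  move=> nX nY; have [h1 h2] := H (Nd X) nX.
  have npX : nneg (leaves (plug c (Nd X))).
    have [a ha] := plug_leaves c.
    by move: np; rewrite !(perm_nneg (ha _)) !nneg_cat => /andP[_ ->];
      rewrite leaves_Node nX.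
  have s0 := ground_ge0 npX.
  rewrite /tree_det pivots_prod_cons cond_sum_cons (pivots_below npX).
  transitivity (pivots_prod Y * ((ground (plug c (Nd X)) * below (plug c (Nd X)) +
    x * below (plug c (Nd X)))
    * (1 + cond_sum Y) + x * (ground (plug c (Nd X)) * below (plug c (Nd X))))).
    by rewrite /cond; field; rewrite gt_eqF //; lra.
  by rewrite h1 h2 below_Node // ground_Node; ring.
have Py : pivots_prod Yv * pivots_prod Yw = pivots_prod B * pivots_prod C.
  by rewrite -!pivots_prod_cat /pivots_prod (perm_big _ pYB).
have Sy : cond_sum Yv + cond_sum Yw =
  cond_sum B + cond_sum C by rewrite -!cond_sum_cat /cond_sum (perm_big _ pYB).
rewrite !FE // Py [pivots_prod C * _]mulrC.
have P0 : 0 < pivots_prod B * pivots_prod C by rewrite mulr_gt0 // pivots_prod_gt0.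
rewrite !(ler_pM2l P0).
set t := k1 + x * k3; have t0 : 0 <= t by rewrite addr_ge0 // mulr_ge0 // ltW.
set r := k2 + x * k4.
have -> : cond_sum C = cond_sum Yv + cond_sum Yw - cond_sum B by rewrite Sy addrC addKr.
pose a := cond_sum Yw - cond_sum B; pose d := cond_sum Yv - cond_sum B.
have a0 : 0 <= a by rewrite subr_ge0.
have d0 : 0 <= d by rewrite subr_ge0.
have -> : cond_sum Yw = cond_sum B + a by rewrite /a; ring.
have -> : cond_sum Yv = cond_sum B + d by rewrite /d; ring.
have ad : 0 <= t * (a * d) by rewrite !mulr_ge0.
(* The linear coefficients of the two sums differ by [x * k1 - r], whose sign tells to which end the
   excess should move; the mixed term adds [t * (a * d)], nonnegative either way. *)
have [le|/ltW le] := lerP r (x * k1); [left|right].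
- have h1 : 0 <= d * (x * k1 - r) by rewrite mulr_ge0 // subr_ge0.
  rewrite -subr_ge0.
  set e := (X in 0 <= X); have -> : e = d * (x * k1 - r) + t * (a * d) by rewrite /e; ring.
  exact: addr_ge0.
- have h1 : 0 <= a * (r - x * k1) by rewrite mulr_ge0 // subr_ge0.
  rewrite -subr_ge0.
  set e := (X in 0 <= X); have -> : e = a * (r - x * k1) + t * (a * d) by rewrite /e; ring.
  exact: addr_ge0.
Qed.

Definition is_leaf (t : tr) := if t is GenTree.Leaf _ then true else false.
Definition leaf_children (ts : seq tr) :=
  pmap (fun t => if t is GenTree.Leaf l then Some l else None) ts.

Lemma leaf_children_perm ts : perm_eq ts (map Lf (leaf_children ts) ++ [seq t <- ts | ~~
  is_leaf t]).
Proof.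
elim: ts => [|[l|n us] ts IH] //=; first by rewrite perm_cons.
by rewrite perm_sym perm_catC /= perm_cons perm_catC perm_sym.
Qed.

Lemma all_leaves_Leaf l : all_leaves (map Lf l) = l.
Proof. by elim: l => //= z l IH; rewrite all_leaves_cons IH. Qed.

Lemma all_arities_Leaf l : all_arities (map Lf l) = [::].
Proof. by elim: l => //= z l IH; rewrite all_arities_cons IH. Qed.

Lemma all_leaves_perm Z Z' : perm_eq Z Z' -> perm_eq (all_leaves Z) (all_leaves Z').
Proof. by move=> h; apply/perm_flatten/perm_map. Qed.

Lemma all_arities_perm Z Z' : perm_eq Z Z' -> perm_eq (all_arities Z) (all_arities Z').
Proof. by move=> h; apply/perm_flatten/perm_map. Qed.

Lemma sorted_cat_le (s1 s2 : seq R) : sorted <=%R (s1 ++ s2) ->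
  {in s1 & s2, forall a b, a <= b}.
Proof.
rewrite (sorted_pairwise le_trans) pairwise_cat => /and3P[/allrelP h _ _] a b.
exact: h.
Qed.

(** [exchange] with [B] the [b] smallest leaves found at the two ends. Internal branches are no
    smaller by hypothesis, so [sum_smallest] bounds [cond_sum B] by both sums; as one end lists
    exactly [b] branches, the arities are preserved. *)
Lemma exchange_leaves b c yv U Y :
  let pl := sort <=%R (yv ++ leaf_children Y) in
  nneg (all_leaves (Nd (map Lf yv) :: U)) ->
  (forall v, same_tree (v :: U) (plug c v :: Y)) ->
  (b <= size yv)%N -> (b <= size Y)%N -> size yv = b \/ size Y = b ->
  {in Y, forall t, ~~ is_leaf t -> {in pl, forall l, l <= ground t}} ->
  exists U', [/\ tree_det (Nd (map Lf (take b pl)) :: U') <= tree_det (Nd (map Lf yv) :: U),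
    perm_eq (tree_arities (Nd (map Lf (take b pl)) :: U')) (tree_arities (Nd (map Lf yv) ::
      U)) &
    perm_eq (all_leaves (Nd (map Lf (take b pl)) :: U')) (all_leaves (Nd (map Lf yv) ::
      U))].
Proof.
move=> pl nn hs byv bY ebs hint.
set B := map Lf (take b pl).
pose C := map Lf (drop b pl) ++ [seq t <- Y | ~~ is_leaf t].
have [ha hl hF] := hs (Nd (map Lf yv)).
have nn' := nn; rewrite (perm_nneg hl) in nn'.
have spl : size pl = (size yv + size (leaf_children Y))%N by rewrite size_sort size_cat.
have pBC : perm_eq (map Lf yv ++ Y) (B ++ C).
  rewrite catA -map_cat cat_take_drop.
  apply: perm_trans (_ : perm_eq _ (map Lf (yv ++ leaf_children Y) ++ [seq t <- Y | ~~
    is_leaf t])) _.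
    by rewrite map_cat -catA perm_cat2l leaf_children_perm.
  by rewrite perm_cat2r perm_map // perm_sym; apply/permPl/perm_sort.
have sB : size B = b by rewrite size_map size_takel // spl (leq_trans byv) ?leq_addr.
have nBC : {in B ++ C, forall t, 0 <= cond (ground t)}.
  move=> t; rewrite -(perm_mem pBC) => tin; apply/cond_ge0/ground_ge0.
  apply: nneg_all_leaves tin; rewrite all_leaves_cat nneg_cat.
  move: nn nn'; rewrite !all_leaves_cons !nneg_cat leaves_Node =>
    /andP[-> _] /andP[_ ->] //.
have lBC : {in B & C, forall t u, cond (ground t) <= cond (ground u)}.
  move=> t u tB uC; apply: cond_le.
    have: nneg (all_leaves (map Lf yv ++ Y)).
      rewrite all_leaves_cat nneg_cat.
      by move: nn nn'; rewrite !all_leaves_cons !nneg_cat leaves_Node =>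
        /andP[-> _] /andP[_ ->].
    by move=> h; apply/ground_ge0/(nneg_all_leaves h); rewrite (perm_mem pBC) mem_cat tB.
  case/mapP: tB => l lB -> /=.
  move: uC; rewrite mem_cat => /orP[/mapP[l' l'C -> /=]|].
    apply: sorted_cat_le lB l'C; rewrite cat_take_drop.
    exact: (sort_sorted (@le_total _ R)).
  rewrite mem_filter => /andP[nL uY].
  by apply: hint => //; apply: mem_take lB.
have yB1 : cond_sum B <= cond_sum (map Lf yv).
  by apply: (sum_smallest pBC) => //; rewrite sB size_map.
have yB2 : cond_sum B <= cond_sum Y.
  apply: (@sum_smallest _ _ _ _ C _ (map Lf yv)) => //; last by rewrite sB.
  by rewrite perm_catC.
have [hB|hC] := exchange nn' pBC yB1 yB2.
- have [U' hU'] := unplug c C; have [a1 l1 F1] := hU' (Nd B).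
  have pl1 := plug_leaves_perm c pBC.
  exists U'; split.
  + by rewrite -F1 ?hF // -(perm_nneg pl1).
  + rewrite perm_sym; apply: perm_trans ha _; apply: perm_trans a1.
    apply: plug_arities_perm => //; rewrite sB size_map.
    by case: ebs => ->; [left|right].
  + rewrite perm_sym; apply: perm_trans hl _; exact: perm_trans l1.
(* Here [B] lies at the root, and one more rerooting turns this vertex into the branch [Nd B]. *)
- have [us hus] := plug_node c C.
  have [a1 l1 F1] := reroot 0 us B; rewrite -hus in a1 l1 F1.
  have pCB : perm_eq (map Lf yv ++ Y) (C ++ B) by rewrite (perm_trans pBC) // perm_catC.
  have pl1 := plug_leaves_perm c pCB.
  exists us; split.
  + by rewrite -F1 ?hF // -(perm_nneg pl1).
  + rewrite perm_sym; apply: perm_trans ha _; apply: perm_trans a1.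
    apply: plug_arities_perm => //.
    have := perm_size pBC; rewrite !size_cat -/C sB !size_map.
    by case: ebs => ->; [move/addnI|rewrite addnC => /addnI]; [right|left].
  + rewrite perm_sym; apply: perm_trans hl _; exact: perm_trans l1.
Qed.

(** Descends through internal children, rerooting along each edge, until all children are leaves. *)
Lemma end_vertex n us rest : exists yv U,
  same_tree (GenTree.Node n us :: rest) (Nd (map Lf yv) :: U).
Proof.
move: {2}(GenTree.Node n us) (erefl (GenTree.Node n us)) => t.
elim/tree_seq_ind: t n us rest => // n ts IH m us rest [-> ->] {m us}.
have [/hasP[[//|m us] tts _]|/hasPn hL] := boolP (has (fun t => ~~ is_leaf t) ts).
  have [yv [U h]] := IH _ tts m us (Nd rest :: rem (GenTree.Node m us) ts) erefl.
  exists yv, U; apply: same_tree_trans h;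
    apply: same_tree_trans (reroot _ _ _) (perm_same_tree _).
  by apply/permP => p /=; rewrite (permP (perm_to_rem tts) p) /= addnCA.
have e : ts = map Lf (leaf_children ts).
  elim: ts hL {IH} => [|[l|k us] ts IHt] //= hL.
    by congr (_ :: _); apply: IHt => t tts; apply: hL; rewrite inE tts orbT.
  by have := hL (GenTree.Node k us); rewrite inE eqxx => /(_ isT).
exists (leaf_children ts), rest; rewrite -e; split=> //.
by move=> _; rewrite /tree_det !pivots_prod_cons !cond_sum_cons !pivots_Node !ground_Node.
Qed.

Lemma occurs_arity b t : b \in arities t -> occurs (fun Y => size Y == b) t.
Proof.
elim/tree_seq_ind: t => //= n ts IH; rewrite inE eq_sym => /orP[->//|].
by move=> /flattenP[a /mapP[t tts ->] bt]; apply/orP; right; apply/hasP; exists t; auto.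
Qed.

Lemma occurs_leaf l t : l \in leaves t -> ~~ is_leaf t -> occurs (fun Y => Lf l \in Y) t.
Proof.
elim/tree_seq_ind: t => //= n ts IH /flattenP[a /mapP[t tts ->] lt] _.
case tE : (is_leaf t); last by apply/orP; right; apply/hasP; exists t => //; apply: IH;
  rewrite ?tE.
by case: t tE lt tts {IH} => //= l' _; rewrite inE => /eqP -> ->.
Qed.

Lemma all_is_leaf ts : all is_leaf ts -> ts = map Lf (leaf_children ts).
Proof. by elim: ts => [|[l|k us] ts IH] //= h; congr (_ :: _); exact: IH. Qed.

Lemma has_internal Z : ~~ all is_leaf Z ->
  exists yv U, same_tree Z (Nd (map Lf yv) :: U).
Proof.
rewrite -has_predC => /hasP[[//|n us] tZ _].
have [yv [U h]] := end_vertex n us (rem (GenTree.Node n us) Z).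
by exists yv, U; apply: same_tree_trans h; apply/perm_same_tree/perm_to_rem.
Qed.

(** A vertex whose neighbours, but at most one, are leaves already provides [b] of them. *)
Lemma size_all_leaves_ge b Z : all (fun a =>
  b <= a)%N (tree_arities Z) -> (b <= size (all_leaves Z))%N.
Proof.
have [/all_is_leaf ->|/has_internal[yv [U [h1 h2 _]]]] := boolP (all is_leaf Z).
  by rewrite all_leaves_Leaf /tree_arities all_arities_Leaf size_map /= andbT =>
    /leq_trans; apply; exact: leq_pred.
rewrite (perm_all _ h1) (perm_size h2) /= size_map => /and3P[_ by_ _].
by rewrite all_leaves_cons leaves_Node all_leaves_Leaf size_cat (leq_trans by_) ?leq_addr.
Qed.

(** The conductance of the vertex whose children are the first [b] leaves of the queue [l]. *)
Definition sigma b (l : seq R) := 1 + \sum_(z <- take b l) cond z.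

Lemma all_leaves_split ts :
  perm_eq (all_leaves ts) (leaf_children ts ++ all_leaves [seq t <- ts | ~~ is_leaf t]).
Proof. by have := all_leaves_perm (leaf_children_perm ts);
  rewrite all_leaves_cat all_leaves_Leaf. Qed.

(** By induction the internal children of [t] are at least [sigma b l], hence above every leaf. So
    the first [b] leaves are the smallest candidates, and [t] has at least [b] children. *)
Lemma sigma_le_ground b l r t :
  sorted <=%R l -> nneg l -> {in l, forall z, z <= sigma b l} -> (b <= size l)%N ->
  all (fun a => b <= a)%N (arities t) -> perm_eq (leaves t ++ r) l -> ~~ is_leaf t ->
  sigma b l <= ground t.
Proof.
move=> sl nl hl bl; elim/tree_seq_ind: t r => // n ts IH r.
rewrite arities_Node leaves_Node [all _ _]/= => /andP[bts ats] pts _;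
  rewrite ground_Node /sigma lerD2l.
set int := [seq t <- ts | ~~ is_leaf t].
have ge_int : {in int, forall t, sigma b l <= ground t}.
  move=> t; rewrite mem_filter => /andP[tL tts].
  have pt := perm_to_rem tts.
  apply: (IH _ tts (all_leaves (rem t ts) ++ r)) => //.
    move: ats; rewrite (perm_all _ (all_arities_perm pt)) all_arities_cons all_cat =>
      /andP[] //.
  rewrite catA; apply: perm_trans pts; rewrite perm_cat2r perm_sym -all_leaves_cons.
  exact: all_leaves_perm.
have nts : nneg (all_leaves ts).
  by move: nl; rewrite -(perm_nneg pts) nneg_cat => /andP[].
have -> : \sum_(z <- take b l) cond z = cond_sum (map Lf (take b l)).
  by rewrite /cond_sum big_map.
(* The children of [t] are padded by all other leaves, those below internal children and [r], so
   that the whole of [l] takes part in the comparison. *)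
apply: (@sum_smallest _ _ _ _ (map Lf (drop b l) ++ int) _ (map Lf (all_leaves int ++ r))).
- rewrite catA -map_cat cat_take_drop.
  apply: (@perm_trans _ ((map Lf (leaf_children ts) ++ int) ++ map Lf (all_leaves int ++
    r))).
    by rewrite perm_cat2r leaf_children_perm.
  rewrite -catA (perm_catCA _ int) perm_catC perm_cat2r -map_cat perm_map //.
  apply: perm_trans pts; rewrite catA perm_cat2r perm_sym; exact: all_leaves_split.
- by rewrite size_map size_takel.
- move=> t; rewrite catA -map_cat cat_take_drop mem_cat => /orP[/mapP[z zl ->]|].
    by apply: cond_ge0 => /=; apply: (allP nl).
  rewrite mem_filter => /andP[_ tts]; apply/cond_ge0/ground_ge0.
  exact: nneg_all_leaves tts.
- move=> _ u /mapP[z zl ->] uC; apply: cond_le => /=.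
    by apply: (allP nl); apply: mem_take zl.
  move: uC; rewrite mem_cat => /orP[/mapP[z' zl' ->]|ui].
    by apply: sorted_cat_le zl zl'; rewrite cat_take_drop.
  by apply: le_trans (ge_int _ ui); apply: hl; apply: mem_take zl.
Qed.

(** * One step of Huffman's algorithm *)

Section Step.
Variables (b : nat) (bs : seq nat) (l : seq R).
Hypotheses (sl : sorted <=%R l) (nl : nneg l).
Hypothesis hl : {in l, forall z, z <= sigma b l}.
Hypothesis bbs : all (fun a => b <= a)%N bs.

Definition state Z := perm_eq (tree_arities Z) bs /\ perm_eq (all_leaves Z) l.

(** The second end is any vertex with a [good] list: one of arity [b] when the end vertex must
    shrink, or one holding a wanted leaf. The remainder [r] records that the pool is part of [l]
    with multiplicities. *)
Lemma exchange_step (good : pred (seq tr)) yv U :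
  state (Nd (map Lf yv) :: U) -> occurs good (Nd U) -> (b <= size yv)%N ->
  (size yv = b \/ forall Y, good Y -> size Y = b) ->
  exists Y U', let yv' := take b (sort <=%R (yv ++ leaf_children Y)) in
    [/\ good Y, tree_det (Nd (map Lf yv') :: U') <= tree_det (Nd (map Lf yv) :: U),
        state (Nd (map Lf yv') :: U') &
        exists r, perm_eq ((yv ++ leaf_children Y) ++ r) l].
Proof.
move=> [sa sl'] occU byv hb.
have [c [Y [gY h]]] := path_to occU.
have [ha hlv _] := h (Nd (map Lf yv)).
have sa2 : perm_eq (tree_arities (plug c (Nd (map Lf yv)) :: Y)) bs.
  by apply: perm_trans sa; rewrite perm_sym.
have sl2 : perm_eq (all_leaves (plug c (Nd (map Lf yv)) :: Y)) l.
  by apply: perm_trans sl'; rewrite perm_sym.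
have /= /andP[bY aY] : all (fun a =>
  b <= a)%N (tree_arities (plug c (Nd (map Lf yv)) :: Y)).
  by rewrite (perm_all _ sa2).
have bl : (b <= size l)%N.
  by rewrite -(perm_size sl2); apply: size_all_leaves_ge; rewrite (perm_all _ sa2).
have [a pa] := plug_leaves c.
have pool : exists r, perm_eq ((yv ++ leaf_children Y) ++ r) l.
  exists (a ++ all_leaves [seq t <- Y | ~~ is_leaf t]); apply: perm_trans sl2.
  rewrite perm_sym all_leaves_cons; apply/permP => p.
  rewrite count_cat (permP (pa _)) (permP (all_leaves_split Y)) !count_cat leaves_Node
    all_leaves_Leaf.
  by rewrite -!addnA; congr addn; rewrite addnCA.
have hint : {in Y, forall t, ~~ is_leaf t ->
    {in sort <=%R (yv ++ leaf_children Y), forall z, z <= ground t}}.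
  move=> t tY tL z; rewrite mem_sort => zp.
  have zl : z \in l.
    by have [r pr] := pool; rewrite -(perm_mem pr) mem_cat zp.
  apply: le_trans (hl zl) _.
  have pt := perm_to_rem tY.
  apply: (sigma_le_ground (r := leaves (plug c (Nd (map Lf yv))) ++ all_leaves (rem t Y)))
    => //.
    move: aY; rewrite all_arities_cons all_cat => /andP[_].
    by rewrite (perm_all _ (all_arities_perm pt)) all_arities_cons all_cat => /andP[].
  apply: perm_trans sl2; rewrite all_leaves_cons perm_catCA perm_cat2l -all_leaves_cons
    perm_sym.
  exact: all_leaves_perm.
have nn : nneg (all_leaves (Nd (map Lf yv) :: U)) by rewrite (perm_nneg sl').
have ebs : size yv = b \/ size Y = b by case: hb => [->|/(_ _ gY)]; [left|right].
have [U' [hF h1 h2]] := exchange_leaves nn h byv bY ebs hint.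
exists Y, U'; split=> //; split.
  exact: perm_trans h1 sa.
exact: perm_trans h2 sl'.
Qed.

(** If the next leaf of [l] is missing at the end vertex, an exchange with a vertex holding it
    brings it over, and the leaves already in place stay because they are among the smallest of the
    pool. *)
Lemma prefix_state j yv U : (j <= b)%N -> size yv = b ->
  state (Nd (map Lf yv) :: U) ->
  exists yv' U' r, [/\ tree_det (Nd (map Lf yv') :: U') <= tree_det (Nd (map Lf yv) :: U),
    size yv' = b, state (Nd (map Lf yv') :: U') & perm_eq yv' (take j l ++ r)].
Proof.
move=> + sy st; elim: j => [|j IH] jb.
  by exists yv, U, yv; split=> //; rewrite take0.
have [yv1 [U1 [r [hF sy1 st1 pr]]]] := IH (ltnW jb).
have [sa1 sl1] := st1.
have jl : (j < size l)%N.
  rewrite -(perm_size sl1) all_leaves_cons leaves_Node all_leaves_Leaf size_cat sy1.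
  exact: leq_trans jb (leq_addr _ _).
have tj : take j.+1 l = rcons (take j l) (nth 0 l j) by rewrite (take_nth 0).
(* Tested in the remainder [r], since an equal value may already occur among the first [j]
   leaves. *)
have [zr|zr] := boolP (nth 0 l j \in r).
  exists yv1, U1, (rem (nth 0 l j) r); split=> //.
  rewrite tj cat_rcons; apply: perm_trans pr _; rewrite perm_cat2l.
  exact: perm_to_rem.
have zU : nth 0 l j \in leaves (Nd U1).
  have : perm_eq (r ++ all_leaves U1) (drop j l).
    rewrite -(perm_cat2l (take j l)) cat_take_drop catA.
    apply: perm_trans sl1; rewrite all_leaves_cons leaves_Node all_leaves_Leaf perm_cat2r
      perm_sym.
    exact: pr.
  move=> /perm_mem /(_ (nth 0 l j)); rewrite mem_cat (negbTE zr) orFb leaves_Node => ->.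
  by rewrite (drop_nth 0 jl) inE eqxx.
have [Y [U2 [gY hF2 st2 [r2 pool]]]] :=
  exchange_step st1 (occurs_leaf zU isT) (eq_leq (esym sy1)) (or_introl sy1).
set pl := sort _ _ in hF2 st2 *.
have zY : nth 0 l j \in leaf_children Y.
  by rewrite /leaf_children mem_pmap; apply/mapP; exists (Lf (nth 0 l j)).
have pp : perm_eq (yv1 ++ leaf_children Y) (take j.+1 l ++ (r ++ rem (nth 0 l j)
  (leaf_children Y))).
  rewrite tj cat_rcons -cat1s.
  apply: perm_trans (_ : perm_eq _ ((take j l ++ r) ++ nth 0 l j :: rem (nth 0 l j)
    (leaf_children Y))) _.
    by apply: perm_cat => //; exact: perm_to_rem.
  by rewrite -catA perm_cat2l -cat1s perm_catCA.
set q := r ++ _ in pp.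
have pq : perm_eq (q ++ r2) (drop j.+1 l).
  rewrite -(perm_cat2l (take j.+1 l)) cat_take_drop catA.
  by apply: perm_trans pool; rewrite perm_cat2r perm_sym.
(* Everything in [q] comes from [drop j.+1 l], so sorting the pool leaves the first [j.+1] leaves in
   front. *)
have plE : pl = take j.+1 l ++ sort <=%R q.
  apply: (sorted_eq (@le_trans _ R) (@le_anti _ R)).
  - exact: (sort_sorted (@le_total _ R)).
  - rewrite (sorted_pairwise le_trans) pairwise_cat -!(sorted_pairwise le_trans).
    rewrite take_sorted // (sort_sorted (@le_total _ R)) !andbT.
    apply/allrelP => u v uT; rewrite mem_sort => vq.
    apply: (@sorted_cat_le (take j.+1 l) (drop j.+1 l)) => //.
      by rewrite cat_take_drop.
    by rewrite -(perm_mem pq) mem_cat vq.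
  - apply: perm_trans (_ : perm_eq _ (yv1 ++ leaf_children Y)) _;
    first exact/permPl/perm_sort.
    apply: perm_trans pp _; rewrite perm_cat2l perm_sym; exact/permPl/perm_sort.
exists (take b pl), U2, (take (b - j.+1) (sort <=%R q)); split=> //.
- exact: le_trans hF2 hF.
- have := perm_size st2.2.
  rewrite size_takel // size_sort size_cat sy1 leq_addr //.
- by rewrite {1}plE take_cat size_takel // ltnNge jb.
Qed.

(** Three stages, none increasing the determinant: some end vertex, then one of the least arity [b],
    then one carrying the first [b] leaves. *)
Lemma greedy_state Z : b \in bs -> ~~ all is_leaf Z -> state Z ->
  exists U, tree_det (Nd (map Lf (take b l)) :: U) <= tree_det Z /\
    state (Nd (map Lf (take b l)) :: U).
Proof.
move=> b_bs /has_internal[yv [U [h1 h2 h3]]] [sa sl'].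
have st : state (Nd (map Lf yv) :: U).
  by split; [apply: perm_trans sa|apply: perm_trans sl']; rewrite perm_sym.
have byv : (b <= size yv)%N.
  by have := bbs; rewrite -(perm_all _ st.1) /= size_map => /and3P[].
have [yv1 [U1 [hF1 sy1 st1]]] : exists yv1 U1,
  [/\ tree_det (Nd (map Lf yv1) :: U1) <= tree_det (Nd (map Lf yv) :: U), size yv1 = b &
      state (Nd (map Lf yv1) :: U1)].
  have [e|ne] := eqVneq (size yv) b; first by exists yv, U.
  have bU : b \in arities (Nd U).
    move: b_bs; rewrite -(perm_mem st.1) /tree_arities all_arities_cons !arities_Node
      all_arities_Leaf /= !inE size_map.
    by rewrite [b == size yv]eq_sym (negbTE ne).
  have [Y [U2 [gY hF2 st2 _]]] := exchange_step st (occurs_arity bU) byv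
     (or_intror (fun Y (h : size Y == b) => elimT eqP h)).
  do 2 eexists; split; [exact: hF2| |exact: st2].
  by rewrite size_takel // size_sort size_cat (leq_trans byv) ?leq_addr.
have [yv2 [U2 [r [hF2 sy2 st2 pr]]]] := prefix_state (leqnn b) sy1 st1.
have bl : (b <= size l)%N.
  by rewrite -(perm_size sl'); apply: size_all_leaves_ge; rewrite (perm_all _ sa).
have r0 : r = [::].
  have := perm_size pr; rewrite size_cat sy2 size_takel // => /eqP.
  by rewrite -{1}[b]addn0 eqn_add2l eq_sym => /eqP/size0nil.
rewrite r0 cats0 in pr.
have pL : perm_eq (map Lf yv2) (map Lf (take b l)) by apply: perm_map.
exists U2; have e : tree_det (Nd (map Lf (take b l)) :: U2) =
  tree_det (Nd (map Lf yv2) :: U2).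
  by rewrite /tree_det !pivots_prod_cons !cond_sum_cons !pivots_Node !ground_Node
    /pivots_prod /cond_sum !(perm_big _ pL).
split.
  by rewrite e h3 ?(perm_nneg sl') //; apply: le_trans hF2 hF1.
split.
  apply: perm_trans st2.1; rewrite /tree_arities !all_arities_cons !arities_Node
    !all_arities_Leaf /=.
  by rewrite (perm_size pL).
apply: perm_trans st2.2; rewrite !all_leaves_cons !leaves_Node !all_leaves_Leaf perm_cat2r
  perm_sym.
exact: pr.
Qed.

End Step.

(* [bs] are the arities in nondecreasing order, [l] the queue of leaves.  The last
   vertex is the root, all of whose [b.+1] branches are leaves. *)
Fixpoint huffman (bs : seq nat) (l : seq R) : R :=
  if bs is b :: bs' then
    if bs' is _ :: _ then
      (\prod_(z <- take b l) (z + x)) * huffman bs' (rcons (drop b l) (sigma b l))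
    else (\prod_(z <- l) (z + x)) * (1 + \sum_(z <- l) cond z)
  else 1.

(** Induction along the arities. The bound of all leaves by [sigma] is the invariant that lets the
    collapsed vertex join the queue at the rear and keep it sorted. *)
Theorem huffman_le bs l Z : sorted leq bs -> sorted <=%R l -> nneg l ->
  {in l, forall z, z <= sigma (head 0%N bs) l} ->
  perm_eq (tree_arities Z) bs -> perm_eq (all_leaves Z) l -> huffman bs l <= tree_det Z.
Proof.
elim: bs l Z => [|b bs IH] l Z sbs sl nl hl pa pl; first by have := perm_size pa.
have all_b : all (fun a => b <= a)%N (b :: bs).
  by rewrite /= leqnn /=; apply: order_path_min sbs; exact: leq_trans.
have {}hl : {in l, forall z, z <= sigma b l} := hl.
case: bs IH sbs pa all_b => [_ _|b2 bs IH sbs] pa all_b.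
  have ZL : all is_leaf Z.
    have := perm_size pa; case: (boolP (all is_leaf Z)) => // /has_internal[yv [U [h _ _]]].
    by rewrite (perm_size h).
  rewrite (all_is_leaf ZL) in pl *; rewrite all_leaves_Leaf in pl.
  rewrite /huffman /tree_det /pivots_prod /cond_sum !big_map /= -!(perm_big _ pl) //.
have nL : ~~ all is_leaf Z.
  apply/negP => /all_is_leaf e; have := perm_size pa.
  by rewrite e /tree_arities all_arities_Leaf.
have [U [hF [sa sl']]] :=
  greedy_state sl nl hl all_b (mem_head _ _) nL (conj pa pl).
apply: le_trans hF; set B := map Lf _ in sa sl' *.
set s := sigma b l.
have ntk : nneg (take b l) by apply/allP => z /mem_take /(allP nl).
have s0 : 0 <= s.
  rewrite addr_ge0 // big_seq sumr_ge0 // => z zt.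
  by apply: cond_ge0; apply: (allP ntk).
(* Collapsing [Nd B] to the leaf [s] keeps its pivot [s + x] and its conductance; only the pivots of
   the leaves in [B] split off. *)
have -> : tree_det (Nd B :: U) = (\prod_(z <- take b l) (z + x)) * tree_det (Lf s :: U).
  have yB : cond_sum B = \sum_(z <- take b l) cond z by rewrite /cond_sum big_map.
  have PB : pivots_prod B = \prod_(z <- take b l) (z + x) by rewrite /pivots_prod big_map.
  by rewrite /tree_det !pivots_prod_cons !cond_sum_cons pivots_Node ground_Node yB PB
    -/(sigma b l) -/s /=; ring.
rewrite [huffman _ _]/= ler_pM2l; last first.
  by rewrite big_seq prodr_gt0 // => z zt; rewrite ltr_wpDl // (allP ntk).
have sU : perm_eq (tree_arities (Lf s :: U)) (b2 :: bs).
  have bl : (b <= size l)%N.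
    by rewrite -(perm_size pl); apply: size_all_leaves_ge; rewrite (perm_all _ pa).
  rewrite -(perm_cons b); apply: perm_trans sa.
  rewrite /tree_arities !all_arities_cons arities_Node /B all_arities_Leaf /= size_map
    size_takel //.
  by apply/permP => p /=; rewrite addnCA.
have lU : perm_eq (all_leaves (Lf s :: U)) (rcons (drop b l) s).
  rewrite perm_sym perm_rcons all_leaves_cons /= perm_cons perm_sym.
  rewrite -(perm_cat2l (take b l)) cat_take_drop.
  by apply: perm_trans sl'; rewrite all_leaves_cons leaves_Node all_leaves_Leaf.
apply: IH => //.
- by case/andP: sbs.
- rewrite -cats1 (sorted_pairwise le_trans) pairwise_cat -!(sorted_pairwise le_trans).
  rewrite drop_sorted //= ?andbT; apply/allrelP => u v /mem_drop ul.
  by rewrite inE => /eqP ->; apply: hl.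
- by rewrite /nneg all_rcons s0; apply/allP => z /mem_drop /(allP nl).
(* The invariant persists: the queue lost its [b] smallest leaves and gained [s], which is no
   smaller, and [b <= b2], so the next collapse sums at least as many terms, none of them
   smaller. *)
have sle : s <= sigma b2 (rcons (drop b l) s).
  have b2l : (b2 <= size (rcons (drop b l) s))%N.
    rewrite -(perm_size lU); apply: size_all_leaves_ge.
    rewrite (perm_all _ sU) /= leqnn /=; apply: order_path_min leq_trans _.
    by case/andP: sbs.
  rewrite {1}/s lerD2l.
  apply: (@sum_smallest _ _ _ _ (rcons (drop b l) s) _
           (drop b2 (rcons (drop b l) s) ++ take b l)).
  - by rewrite catA cat_take_drop perm_catC.
  - rewrite size_take_min geq_min; apply/orP; left; rewrite size_takel //.
    by case/andP: sbs.
  - move=> z; rewrite -cats1 catA cat_take_drop mem_cat inE => /orP[zl|/eqP->].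
      by apply: cond_ge0; apply: (allP nl).
    exact: cond_ge0.
  - move=> z z' zt; rewrite mem_rcons inE => z'd; apply: cond_le.
      exact: (allP ntk).
    case/orP: z'd => [/eqP ->|z'd]; first by apply: hl; apply: mem_take zt.
    by apply: sorted_cat_le zt z'd; rewrite cat_take_drop.
move=> z; rewrite mem_rcons inE => /orP[/eqP-> //|/mem_drop zl].
by apply: le_trans sle; apply: hl.
Qed.

End Rose.

(** * Trees given by a parent array *)

Definition pgraph n (p : nat -> nat) : rel 'I_n :=
  fun i j => (0 < i)%N && (p i == j) || (0 < j)%N && (p j == i).

Section ParentArray.
Variables (n : nat) (p : nat -> nat).
Hypothesis p_lt : forall i, (0 < i < n)%N -> (p i < i)%N.

Definition nkids i := count (fun j => p j == i) (iota 1 n.-1).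

Lemma big_kids (V : Type) (idx : V) (op : Monoid.com_law idx) (F : nat -> V) i :
  \big[op/idx]_(j < n | (0 < j)%N && (p j == i)) F j =
  \big[op/idx]_(j <- iota 1 n.-1 | p j == i) F j.
Proof.
case: n => [|m] /=; first by rewrite big_ord0 big_nil.
rewrite big_mkcond big_ord_recl /= Monoid.mul1m -big_mkcond /=.
rewrite -[1%N]addn0 iotaDl big_map.
have -> : iota 0 m = index_iota 0 m by rewrite /index_iota subn0.
by rewrite big_mkord; apply: eq_bigl => j; rewrite /= /bump add1n.
Qed.

Lemma degree_pgraph (i : 'I_n) : degree (pgraph p) i = ((0 < i) + nkids i)%N.
Proof.
rewrite /degree -sum1_card big_mkcond /=.
transitivity (\sum_(j < n) (((0 < i)%N && (p i == j)) + ((0 < j)%N && (p j == i))))%N.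
  apply: eq_bigr => j _; rewrite inE /pgraph.
  have [|] := boolP ((0 < i)%N && (p i == j));
    have [|] := boolP ((0 < j)%N && (p j == i)) => //.
  move=> /andP[j0 /eqP pj] /andP[i0 /eqP pi].
  have := p_lt (_ : (0 < i < n)%N); have := p_lt (_ : (0 < j < n)%N).
  rewrite i0 j0 !ltn_ord pj pi => /(_ isT) h1 /(_ isT) h2.
  by have := ltn_trans h1 h2; rewrite ltnn.
rewrite big_split /=; congr addn.
  have [i0|i0] := posnP (i : nat); first by rewrite big1.
  have pin : (p i < n)%N by rewrite (ltn_trans (p_lt _) (ltn_ord i)) // i0 ltn_ord.
  rewrite (bigD1 (Ordinal pin)) //= eqxx big1 // => j.
  by rewrite -val_eqE /= eq_sym => /negbTE ->.
rewrite /nkids -sum1_count -big_kids [RHS]big_mkcond /=.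
by apply: eq_bigr => j _; case: ifP.
Qed.

(** Every nonzero vertex has exactly one parent. Recursions over subtrees telescope through this
    identity. *)
Lemma big_partition_kids (V : Type) (idx : V) (op : Monoid.com_law idx) (F : nat -> V) :
  \big[op/idx]_(i <- iota 0 n) \big[op/idx]_(j <- iota 1 n.-1 | p j == i) F j =
  \big[op/idx]_(j <- iota 1 n.-1) F j.
Proof.
rewrite (exchange_big_dep predT) //=; apply: eq_big_seq => j.
rewrite mem_iota => /andP[j1 jn].
have jn' : (j < n)%N by lia.
have pn : (p j < n)%N by rewrite (ltn_trans (p_lt _) jn') // j1.
rewrite -big_filter (_ : [seq i <- iota 0 n | p j == i] = [:: p j]) ?big_seq1 //.
rewrite (eq_filter (a2 := pred1 (p j))) => [|i]; last by rewrite /= eq_sym.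
by rewrite filter_pred1_uniq ?iota_uniq // mem_iota.
Qed.

(** * Gaussian elimination of [I + x L] *)

Section Eliminate.
Variables (R : realFieldType) (x : R).
Hypothesis x_gt0 : 0 < x.
Notation cond := (cond x).
Variable s : nat -> R.
Hypothesis s_gt0 : forall i, (i < n)%N -> 0 < s i.
Hypothesis sE : forall i, (i < n)%N ->
  s i = 1 + \sum_(j <- iota 1 n.-1 | p j == i) cond (s j).

(* Gaussian elimination from the last vertex to the first, as a factorisation
   [U D U^T] with [U] unitriangular. *)
Definition elim_U : 'M[R]_n := \matrix_(i, k)
  ((i == k)%:R - ((0 < k)%N && (p k == i))%:R * (x / (s k + x))).
Definition elim_D : 'rV[R]_n := \row_k (s k + (0 < k)%:R * x).

Lemma det_elim_U : \det elim_U = 1.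
Proof.
rewrite -det_tr det_trig.
  rewrite big1 // => i _; rewrite !mxE eqxx.
  case: (posnP i) => i0 /=; first by rewrite mul0r subr0.
  rewrite (_ : (p i == i) = false) ?mul0r ?subr0 //.
  by apply/negbTE; rewrite neq_ltn p_lt // i0 ltn_ord.
apply/is_trig_mxP => i j ij; rewrite !mxE.
have -> : (j == i) = false by apply/negbTE; rewrite -val_eqE neq_ltn ij orbT.
case: (posnP i) => i0 /=; first by rewrite mul0r subr0.
rewrite (_ : (p i == j) = false) ?mul0r ?subr0 //.
apply/negbTE; rewrite neq_ltn (ltn_trans (p_lt _) ij) //.
by rewrite i0 ltn_ord.
Qed.

(** On the diagonal each child [k] contributes [x ^+ 2 / (s k + x) = x - cond (s k)], which [sE]
    absorbs. Off the diagonal no [k] has both [i] and [j] as parent, so only the edge terms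
    remain. *)
Lemma elim_mx : elim_U *m diag_mx elim_D *m elim_U^T =
  \matrix_(i, j) ((i == j)%:R + x * ((degree (pgraph p) i)%:R *+ (i == j) - (pgraph p i
    j)%:R)).
Proof.
have s0 (k : 'I_n) : s k + x != 0.
  by rewrite gt_eqF // addr_gt0 // s_gt0.
apply/matrixP => i j; rewrite !mxE.
pose a (i k : 'I_n) : R := ((0 < k)%N && (p k == i))%:R * (x / (s k + x)).
pose d (k : 'I_n) : R := s k + (0 < k)%:R * x.
transitivity (\sum_k ((i == k)%:R * (j == k)%:R * d k - (j == k)%:R * (a i k * d k)
    - (i == k)%:R * (a j k * d k) + a i k * a j k * d k)).
  apply: eq_bigr => k _.
  rewrite mul_mx_diag !mxE -/(a i k) -/(a j k) -/(d k); ring.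
have pick (F : 'I_n -> R) i0 : \sum_k (i0 == k)%:R * F k = F i0.
  rewrite (bigD1 i0) //= eqxx mul1r big1 ?addr0 // => k.
  by rewrite eq_sym => /negbTE ->; rewrite mul0r.
have ad (i0 k : 'I_n) : a i0 k * d k = ((0 < k)%N && (p k == i0))%:R * x.
  rewrite /a /d; case: (posnP k) => k0 /=; first by rewrite !mul0r.
  by rewrite !mul1r -mulrA divfK.
rewrite !big_split /= !sumrN !pick !ad.
under eq_bigr do rewrite -mulrA; rewrite pick.
under eq_bigr do rewrite -mulrA ad mulrCA.
rewrite /pgraph.
have [<-|neq] := eqVneq i j; last first.
  rewrite mulr0n !mul0r add0r sub0r big1; last first.
    move=> k _; rewrite /a.
    case: (posnP k) => k0 /=; rewrite ?mul0r ?mulr0 //.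
    case: eqP => [->|]; rewrite ?mul0r ?mulr0 //.
    rewrite (_ : (j == i :> nat) = false) ?mul0r ?mulr0 //.
    by apply/negbTE; rewrite eq_sym.
  have -> : (((0 < i)%N && (p i == j)) || ((0 < j)%N && (p j == i)))%:R =
     ((0 < i)%N && (p i == j))%:R + ((0 < j)%N && (p j == i))%:R :> R.
    have [|] := boolP ((0 < i)%N && (p i == j));
      have [|] := boolP ((0 < j)%N && (p j == i));
      rewrite ?add0r ?addr0 //.
    move=> /andP[j0 /eqP pj] /andP[i0 /eqP pi].
    have := p_lt (_ : (0 < i < n)%N); have := p_lt (_ : (0 < j < n)%N).
    rewrite i0 j0 !ltn_ord pj pi => /(_ isT) h1 /(_ isT) h2.
    by have := ltn_trans h1 h2; rewrite ltnn.
  by ring.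
have pii : ((0 < i)%N && (p i == i)) = false.
  case: (posnP i) => //= i0; apply/negbTE; rewrite neq_ltn p_lt // i0 ltn_ord //.
rewrite pii mulr1n /= mul0r !subr0 mul1r degree_pgraph // natrD.
have -> : \sum_(k < n) ((0 < k)%N && (p k == i))%:R * (a i k * x) =
   \sum_(k <- iota 1 n.-1 | p k == i) (x - cond (s k)).
  rewrite -(big_kids _ (fun k => x - cond (s k))) [RHS]big_mkcond /=.
  apply: eq_bigr => k _; rewrite /a; case: (_ && _); last by rewrite mul0r.
  rewrite !mul1r /cond; field; exact: s0.
rewrite big_split /= sumrN.
have -> : \sum_(k <- iota 1 n.-1 | p k == i) x = (nkids i)%:R * x.
  by rewrite big_const_seq iter_addr_0 mulr_natl.
rewrite /d {1}sE //; ring.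
Qed.

Lemma det_pgraph :
  \det (\matrix_(i < n, j < n) ((i == j)%:R + x * ((degree (pgraph p) i)%:R *+ (i == j)
     - (pgraph p i j)%:R))) = \prod_(k < n) (s k + (0 < k)%:R * x).
Proof.
rewrite -elim_mx !det_mulmx det_tr det_elim_U mulr1 mul1r det_diag.
by apply: eq_bigr => k _; rewrite mxE.
Qed.

End Eliminate.

(** * Rose trees read off a parent array *)

Section RoseOf.
Variable R : realFieldType.
Notation tr := (GenTree.tree R).

(** A childless vertex becomes [Leaf 1] rather than an empty node, so that [arities] lists internal
    vertices only and [leaves] the actual leaves. *)
Definition collapse (ts : seq tr) : tr :=
  if ts is [::] then GenTree.Leaf 1 else GenTree.Node 0 ts.

(* Fuel [n - i] suffices at [i], as children have larger indices. *)
Fixpoint rose_fuel m i : tr :=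
  if m is m'.+1 then collapse [seq rose_fuel m' j | j <- iota 1 n.-1 & p j == i]
  else GenTree.Leaf 1.

Definition rose i := rose_fuel n i.
Definition kids i := [seq rose j | j <- iota 1 n.-1 & p j == i].

Lemma rose_fuelE m m' i : (i < n)%N -> (n - i <= m)%N -> (n - i <= m')%N ->
  rose_fuel m i = rose_fuel m' i.
Proof.
elim: m m' i => [|m IH] [|m'] i hi; try by lia.
move=> h1 h2 /=; congr collapse; apply/eq_in_map => j.
rewrite mem_filter mem_iota => /andP[/eqP pj hj].
have jn : (0 < j < n)%N by lia.
by have := p_lt jn; rewrite pj => ij; apply: IH; lia.
Qed.

Lemma roseE i : (i < n)%N -> rose i = collapse (kids i).
Proof.
move=> hi; rewrite /rose (@rose_fuelE n n.+1) //=; lia.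
Qed.

Lemma all_leaves_count a Z : count a (@all_leaves R Z) =
  (\sum_(t <- Z) count a (leaves t))%N.
Proof. by rewrite /all_leaves count_flatten sumnE !big_map. Qed.

Lemma all_arities_count a Z : count a (@all_arities R Z) =
  (\sum_(t <- Z) count a (arities t))%N.
Proof. by rewrite /all_arities count_flatten sumnE !big_map. Qed.

Lemma kids_big (V : Type) (idx : V) (op : Monoid.com_law idx) (F : tr -> V) i :
  \big[op/idx]_(t <- kids i) F t = \big[op/idx]_(j <- iota 1 n.-1 | p j == i) F (rose j).
Proof. by rewrite big_map big_filter. Qed.

Lemma size_kids i : size (kids i) = nkids i.
Proof. by rewrite size_map size_filter. Qed.

Lemma iota_n : (0 < n)%N -> iota 0 n = 0%N :: iota 1 n.-1.
Proof. by case: n. Qed.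

(** Summed over all nonzero vertices, the recursion for subtree counts telescopes by
    [big_partition_kids] and leaves the children of [0]. The same device serves [all_arities_kids0]
    and, with products, [tree_det_kids0]. *)
Lemma all_leaves_kids0 : (0 < n)%N ->
  perm_eq (all_leaves (kids 0%N)) (nseq (count (fun i => nkids i == 0%N) (iota 1 n.-1)) 1).
Proof.
move=> n0; apply/permP => a; rewrite count_nseq all_leaves_count kids_big.
have h : (\sum_(i <- iota 1 n.-1) count a (leaves (rose i)) =
   \sum_(i <- iota 1 n.-1) (a 1%R * (nkids i == 0)%N +
      \sum_(j <- iota 1 n.-1 | p j == i) count a (leaves (rose j))))%N.
  apply: eq_big_seq => i; rewrite mem_iota => hi.
  rewrite roseE; last by lia.
  rewrite -size_kids -(kids_big _ (fun t => count a (leaves t))) -all_leaves_count.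
  by case: (kids i) => [|t ts]; rewrite /= ?muln1 // (muln0 (a 1%R)).
move: h; rewrite big_split /=.
have := big_partition_kids addn (fun j => count a (leaves (rose j))).
rewrite iota_n // big_cons /= => <- /addIn ->.
by rewrite -big_distrr /= -sum1_count [in RHS]big_mkcond; congr (_ * _)%N;
  apply: eq_bigr => i _; case: eqP.
Qed.

Lemma all_arities_kids0 : (0 < n)%N ->
  perm_eq (all_arities (kids 0%N)) [seq k <- [seq nkids i | i <- iota 1 n.-1] | k != 0%N].
Proof.
move=> n0; apply/permP => a; rewrite count_filter count_map all_arities_count kids_big.
have h : (\sum_(i <- iota 1 n.-1) count a (arities (rose i)) =
   \sum_(i <- iota 1 n.-1) ((a (nkids i) && (nkids i != 0)) +
      \sum_(j <- iota 1 n.-1 | p j == i) count a (arities (rose j))))%N.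
  apply: eq_big_seq => i; rewrite mem_iota => hi.
  rewrite roseE; last by lia.
  rewrite -size_kids -(kids_big _ (fun t => count a (arities t))) -all_arities_count.
  by case: (kids i) => [|t ts] //=; rewrite ?andbF ?andbT //.
move: h; rewrite big_split /=.
have := big_partition_kids addn (fun j => count a (arities (rose j))).
rewrite iota_n // big_cons /= => <- /addIn ->.
by rewrite -sum1_count [in RHS]big_mkcond; apply: eq_bigr => i _ /=; case: (_ && _).
Qed.

Lemma nneg_rose i : nneg (leaves (rose i)).
Proof.
rewrite /rose; move: {1}n i; elim=> [|m IH] i /=; first by rewrite ler01.
have : nneg (all_leaves [seq rose_fuel m j | j <- iota 1 n.-1 & p j == i]).
  elim: [seq _ <- _ | _] => //= j js IHj; rewrite all_leaves_cons nneg_cat IH; exact: IHj.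
by case: [seq _ | _ <- _] => //= _; rewrite ler01.
Qed.

Variable x : R.
Hypothesis x_gt0 : 0 < x.

Lemma ground_collapse ts : ground x (collapse ts) = 1 + cond_sum x ts.
Proof. by case: ts => [|t ts]; rewrite /collapse ?ground_Node // /cond_sum big_nil addr0.
  Qed.

Lemma pivots_collapse ts : pivots x (collapse ts) =
  (1 + cond_sum x ts + x) * pivots_prod x ts.
Proof. by case: ts => [|t ts]; rewrite /collapse ?pivots_Node // /cond_sum /pivots_prod
  !big_nil addr0 mulr1. Qed.

Lemma ground_rose_gt0 i : (i < n)%N -> 0 < ground x (rose i).
Proof.
move=> hi; rewrite roseE // ground_collapse ltr_wpDr // cond_sum_ge0 // => t /mapP[j _ ->].
by apply: ground_ge0 => //; exact: nneg_rose.
Qed.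

Lemma ground_roseE i : (i < n)%N ->
  ground x (rose i) = 1 + \sum_(j <- iota 1 n.-1 | p j == i) cond x (ground x (rose j)).
Proof.
move=> hi; rewrite {1}roseE // ground_collapse; congr (_ + _).
by rewrite /cond_sum (kids_big _ (fun t => cond x (ground x t))).
Qed.

Lemma det_rose : (0 < n)%N ->
  \det (\matrix_(i < n, j < n) ((i == j)%:R + x * ((degree (pgraph p) i)%:R *+ (i == j)
     - (pgraph p i j)%:R))) = ground x (rose 0%N) * \prod_(k <- iota 1 n.-1) (ground x
       (rose k) + x).
Proof.
move=> n0; rewrite (det_pgraph x_gt0 ground_rose_gt0 ground_roseE).
rewrite -(big_mkord predT (fun k => ground x (rose k) + (0 < k)%:R * x)).
rewrite /index_iota subn0 iota_n // big_cons mul0r addr0; congr (_ * _).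
by apply: eq_big_seq => k; rewrite mem_iota => /andP[-> _]; rewrite mul1r.
Qed.

Lemma tree_det_kids0 : (0 < n)%N ->
  ground x (rose 0%N) * \prod_(k <- iota 1 n.-1) (ground x (rose k) + x) =
    tree_det x (kids 0%N).
Proof.
move=> n0; rewrite roseE // ground_collapse /tree_det mulrC; congr (_ * _).
rewrite /pivots_prod (kids_big _ (pivots x)).
have h : \prod_(i <- iota 1 n.-1) pivots x (rose i) =
   \prod_(i <- iota 1 n.-1) ((ground x (rose i) + x) *
      \prod_(j <- iota 1 n.-1 | p j == i) pivots x (rose j)).
  apply: eq_big_seq => i; rewrite mem_iota => hi.
  have hi' : (i < n)%N by lia.
  by rewrite !(roseE hi') pivots_collapse ground_collapse /pivots_prod (kids_big _ (pivots
    x)).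
move: h; rewrite big_split /=.
have := big_partition_kids *%R (fun j => pivots x (rose j)).
rewrite iota_n // big_cons /= => <-.
move/mulIf => -> //; rewrite gt_eqF //.
by do 2 (rewrite prodr_gt0 // => ? _); exact/pivots_gt0/nneg_rose.
Qed.

End RoseOf.
End ParentArray.

(** * The greedy tree *)

Section Greedy.
Variable D : seq nat.
Let n := size D.
Hypothesis n_gt0 : (0 < n)%N.
Hypothesis D_sorted : sorted geq D.
Hypothesis D_pos : forall i, (0 < i < n)%N -> (0 < nth 0 D i)%N.
Hypothesis D0_pos : (1 < n)%N -> (0 < nth 0 D 0)%N.
Hypothesis D_sum : sumn D = (2 * n.-1)%N.

Definition greedy_arity i := (nth 0 D i - (0 < i))%N.
(* In the greedy tree the children of [i] are named [greedy_start i], ...,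
   [greedy_start i.+1 - 1]. *)
Definition greedy_start i := (1 + \sum_(u < i) greedy_arity u)%N.

Lemma greedy_startS i : greedy_start i.+1 = (greedy_start i + greedy_arity i)%N.
Proof. by rewrite /greedy_start big_ord_recr addnA. Qed.

Lemma greedy_start_le i j : (i <= j)%N -> (greedy_start i <= greedy_start j)%N.
Proof.
move=> /subnKC <-; elim: (j - i)%N => [|k IH]; rewrite ?addn0 // addnS greedy_startS.
exact: leq_trans IH (leq_addr _ _).
Qed.

(** Of the degree sum [2 * n.-1], the edges to parents take [n.-1]; the other [n.-1] count the
    children, and the root adds one. *)
Lemma greedy_start_size : greedy_start n = n.
Proof.
have h : (\sum_(u < n) greedy_arity u + n.-1 = sumn D)%N.
  rewrite sumnE (big_nth 0%N) big_mkord -/n.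
  have -> : n.-1 = (\sum_(u < n) (0 < u))%N.
    by case: n => [|m]; rewrite ?big_ord0 // big_ord_recl add0n sum1_card card_ord.
  rewrite -big_split /=; apply: eq_bigr => u _; rewrite /greedy_arity.
  case: (posnP u) => u0; first by rewrite subn0 addn0.
  by rewrite subnK // D_pos // u0 ltn_ord.
rewrite /greedy_start; move: h n_gt0; rewrite D_sum; lia.
Qed.

Lemma greedy_arity_mono i j : (0 < i)%N -> (i <= j < n)%N ->
  (greedy_arity j <= greedy_arity i)%N.
Proof.
move=> i0 /andP[ij jn]; rewrite /greedy_arity i0 (leq_trans i0 ij) leq_sub2r //.
have tr : transitive geq by move=> a b c /= h1 h2; exact: leq_trans h2 h1.
have := sorted_leq_nth tr (fun a => leqnn a) 0%N D_sorted.
by apply => //; rewrite inE // (leq_ltn_trans ij).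
Qed.

(** The queue never runs empty early: after a nonzero vertex without children all later ones have
    none either, so [greedy_start] has already reached its final value [n]. *)
Lemma greedy_start_gt i : (i < n)%N -> (i < greedy_start i)%N.
Proof.
elim: i => [//|i IH] hi; have := IH (ltnW hi); rewrite greedy_startS.
have [b0|b0] := posnP (greedy_arity i); last by lia.
have i0 : (0 < i)%N.
  case: i b0 hi {IH} => // b0 hi; have := D0_pos hi.
  by move: b0; rewrite /greedy_arity subn0 => ->.
have h k : (i + k <= n)%N -> greedy_start (i + k) = greedy_start i.
  elim: k => [|k IHk] hk; first by rewrite addn0.
  rewrite addnS greedy_startS IHk; last by lia.
  have := @greedy_arity_mono i (i + k) i0; rewrite b0 => h; lia.
have := h (n - i)%N; rewrite subnKC ?(ltnW (ltnW hi)) // greedy_start_size =>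
  /(_ (leqnn _)).
lia.
Qed.

Lemma greedy_start_le_size i : (i <= n)%N -> (greedy_start i <= n)%N.
Proof. by move=> hi; rewrite -[X in (_ <= X)%N]greedy_start_size greedy_start_le. Qed.

Definition greedy_parent j := find (fun i => j < greedy_start i.+1)%N (iota 0 n).

Lemma greedy_parentE j i : (0 < j < n)%N -> (i < n)%N ->
  (greedy_parent j == i) = (greedy_start i <= j < greedy_start i.+1)%N.
Proof.
move=> /andP[j0 jn] hi; rewrite /greedy_parent.
set a := fun i => (j < greedy_start i.+1)%N.
have ha : has a (iota 0 n).
  apply/hasP; exists n.-1; first by rewrite mem_iota /= prednK.
  by rewrite /a prednK // greedy_start_size.
have hf : (find a (iota 0 n) < n)%N by rewrite -[X in (_ < X)%N](size_iota 0 n) -has_find.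
apply/eqP/andP => [<-|[h1 h2]].
  split; last by have := nth_find 0 ha; rewrite nth_iota.
  case E : (find a (iota 0 n)) => [|k]; first by rewrite /greedy_start big_ord0.
  have := @before_find _ 0%N a (iota 0 n) k; rewrite E ltnSn nth_iota; last by lia.
  by move=> /(_ isT) /negbT; rewrite /a -leqNgt.
apply/eqP; rewrite eqn_leq; apply/andP; split.
  rewrite leqNgt; apply/negP => /(before_find 0%N); rewrite nth_iota // /a add0n.
  by rewrite h2.
rewrite leqNgt; apply/negP => lt.
have := nth_find 0 ha; rewrite nth_iota // /a add0n => h3.
by have := leq_trans h3 (leq_trans (greedy_start_le lt) h1); rewrite ltnn.
Qed.

Lemma greedy_parent_lt j : (0 < j < n)%N -> (greedy_parent j < j)%N.
Proof.
move=> hj; have gn : (greedy_parent j < n)%N.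
  rewrite /greedy_parent -[X in (_ < X)%N](size_iota 0 n) -has_find; apply/hasP;
    exists n.-1.
    by rewrite mem_iota /= prednK.
  by rewrite prednK // greedy_start_size; case/andP: hj.
have := greedy_parentE hj gn; rewrite eqxx => /esym /andP[h _].
exact: leq_trans (greedy_start_gt gn) h.
Qed.

Lemma greedy_parent_kids i : (i < n)%N ->
  [seq j <- iota 1 n.-1 | greedy_parent j == i] = iota (greedy_start i) (greedy_arity i).
Proof.
move=> hi; apply: (irr_sorted_eq ltn_trans ltnn).
- by apply: sorted_filter; [exact: ltn_trans|exact: iota_ltn_sorted].
- exact: iota_ltn_sorted.
move=> j; rewrite mem_filter !mem_iota -greedy_startS add1n prednK //.
have [hj|hj] := boolP (0 < j < n)%N; first by rewrite greedy_parentE // andbT.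
rewrite andbF; apply/esym/negbTE; apply: contra hj => /andP[h1 h2].
by have := greedy_start_le_size hi; have := greedy_start_gt hi; lia.
Qed.

Lemma nkids_greedy_parent i : (i < n)%N -> nkids n greedy_parent i = greedy_arity i.
Proof. by move=> hi; rewrite /nkids -size_filter greedy_parent_kids // size_iota. Qed.

Lemma zip_map_self (A B : Type) (f : A -> B) s : zip s (map f s) = map (fun u =>
  (u, f u)) s.
Proof. by elim: s => //= u s ->. Qed.

(** The loop invariant when vertex [v] is about to be processed; [greedy_start_gt] keeps the queue
    nonempty. *)
Lemma greedy_arcsE fuel v : (v + fuel = n)%N ->
  greedy_arcs fuel [seq (u, greedy_arity u) | u <- iota v (greedy_start v - v)]
    (greedy_start v) (drop (greedy_start v) D) =
  flatten [seq [seq (u, w) | w <- iota (greedy_start u) (greedy_arity u)] | u <- iota v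
    fuel].
Proof.
elim: fuel v => [|f IH] v hv; first by case: (iota v _).
have vn : (v < n)%N by lia.
have vc := greedy_start_gt vn.
have [k hk] : exists k, (greedy_start v - v = k.+1)%N by exists (greedy_start v - v).-1;
  lia.
rewrite hk /=; congr (_ ++ _).
have gl := greedy_start_le_size vn.
have -> : [seq d.-1 | d <- take (greedy_arity v) (drop (greedy_start v) D)] =
  map greedy_arity (iota (greedy_start v) (greedy_arity v)).
  apply: (@eq_from_nth _ 0%N).
    by rewrite !size_map size_iota size_takel // size_drop; move: gl;
      rewrite greedy_startS -/n; lia.
  move=> i; rewrite size_map => hi0.
  have hi : (i < greedy_arity v)%N by move: hi0; rewrite size_take_min; lia.
  rewrite (nth_map 0%N) // nth_take // nth_drop (nth_map 0%N) ?size_iota //.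
  by rewrite nth_iota // /greedy_arity;
    rewrite (_ : (0 < greedy_start v + i)%N) /= ?subn1 //; lia.
rewrite zip_map_self -map_cat -greedy_startS drop_drop.
have -> : iota v.+1 k ++ iota (greedy_start v) (greedy_arity v) =
  iota v.+1 (greedy_start v.+1 - v.+1).
  have -> : (greedy_start v.+1 - v.+1 = k + greedy_arity v)%N by rewrite greedy_startS; lia.
  by rewrite iotaD; have -> : (v.+1 + k = greedy_start v)%N by lia.
by rewrite addnC -greedy_startS IH //; lia.
Qed.

Lemma greedy_treeE : greedy_tree D = @pgraph n greedy_parent.
Proof.
have E (i j : 'I_n) : ((i : nat, j : nat) \in
    greedy_arcs (size D) [:: (0%N, head 0%N D)] 1%N (behead D)) =
    (0 < j)%N && (greedy_parent j == i).
  have := @greedy_arcsE n 0 (add0n _).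
  have -> : greedy_start 0 = 1%N by rewrite /greedy_start big_ord0.
  rewrite subn0 /= drop1 /greedy_arity /= subn0 nth0 => ->.
  have -> : ((0 < j)%N && (greedy_parent j == i)) =
    (greedy_start i <= j < greedy_start i.+1)%N.
    case: (posnP j) => j0 /=; last by rewrite greedy_parentE // j0 ltn_ord.
    by rewrite j0; apply/esym/negbTE; rewrite negb_and -ltnNge;
      have := greedy_start_gt (ltn_ord i); lia.
  apply/flattenP/idP => [[s /mapP[u]]|h].
    rewrite mem_iota => hu -> /mapP[w].
    by rewrite mem_iota -greedy_startS => hw [-> ->].
  exists [seq (i : nat, w) | w <- iota (greedy_start i) (greedy_arity i)].
    by apply: map_f; rewrite mem_iota /= ltn_ord.
  by apply: map_f; rewrite mem_iota -greedy_startS.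
apply/funext => i; apply/funext => j; rewrite /greedy_tree !E /pgraph orbC //.
Qed.

Lemma degree_greedy (i : 'I_n) : degree (greedy_tree D) i = nth 0%N D i.
Proof.
rewrite greedy_treeE (degree_pgraph greedy_parent_lt) nkids_greedy_parent // /greedy_arity
  addnC.
case: (posnP i) => i0; first by rewrite subn0 addn0.
by rewrite subnK // D_pos // i0 ltn_ord.
Qed.

Lemma degree_sequence_greedy : degree_sequence (greedy_tree D) = D.
Proof.
rewrite /degree_sequence (eq_map degree_greedy).
rewrite (map_comp (nth 0%N D) val) val_enum_ord map_nth_iota0 // take_size.
apply: sorted_sort => // a b c /= h1 h2; exact: leq_trans h2 h1.
Qed.

(** * The Huffman value of the greedy tree *)

Section Huff.
Variables (R : realFieldType) (x : R).
Hypothesis x_gt0 : 0 < x.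

Notation s i := (ground x (rose n greedy_parent R i)).

(** Degrees [1] beyond the head belong to leaves and are dropped. The root is always kept, and comes
    last because its degree is largest. *)
Definition arities_of := rev ((head 0%N D).-1 :: [seq d.-1 | d <- behead D & (1 < d)%N]).

(* After the vertices above [i] have been collapsed, the queue consists of the
   vertices above [i] whose parent is at most [i], in decreasing order. *)
Lemma huffman_greedy_step i : (i < n)%N ->
  huffman x (rev ((head 0%N D).-1 :: [seq greedy_arity j | j <- iota 1 i]))
    [seq s j | j <- rev (iota i.+1 (greedy_start i.+1 - i.+1))] =
  s 0%N * \prod_(j <- iota 1 (greedy_start i.+1 - 1)) (s j + x).
Proof.
have sE u : (u < n)%N -> s u = 1 +
  \sum_(j <- iota (greedy_start u) (greedy_arity u)) cond x (s j).
  by move=> hu; rewrite {1}(ground_roseE greedy_parent_lt x hu) -big_filter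
    greedy_parent_kids.
elim: i => [|i IH] hi.
  have e1 : greedy_start 1 = (greedy_arity 0).+1 by rewrite greedy_startS /greedy_start
    big_ord0.
  have e0 : greedy_start 0 = 1%N by rewrite /greedy_start big_ord0.
  rewrite e1 subn1 /= sE // e0 mulrC.
  by rewrite !big_map !(perm_big _ (permEl (perm_rev _))).
have -> : rev ((head 0%N D).-1 :: [seq greedy_arity j | j <- iota 1 i.+1]) =
  greedy_arity i.+1 :: rev ((head 0%N D).-1 :: [seq greedy_arity j | j <- iota 1 i]).
  have -> : iota 1 i.+1 = rcons (iota 1 i) i.+1 by rewrite -[X in
    iota 1 X]addn1 iotaD cats1.
  by rewrite map_rcons -rcons_cons rev_rcons.
have [b0 [bs Ebs]] : exists b0 bs,
  rev ((head 0%N D).-1 :: [seq greedy_arity j | j <- iota 1 i]) = b0 :: bs.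
  case E : (rev _) => [|b0 bs]; last by exists b0, bs.
  by have := congr1 size E; rewrite size_rev.
have ic := greedy_start_gt hi.
(* The children of [i.+1] stand first in the queue, so exactly these are collapsed, and by [sE] the
   resulting leaf is [s i.+1]. *)
have Eq : [seq s j | j <- rev (iota i.+2 (greedy_start i.+2 - i.+2))] =
   [seq s j | j <- rev (iota (greedy_start i.+1) (greedy_arity i.+1))] ++
   [seq s j | j <- rev (iota i.+2 (greedy_start i.+1 - i.+2))].
  rewrite -map_cat -rev_cat; congr (map _ (rev _)).
  have -> : (greedy_start i.+2 - i.+2 =
    (greedy_start i.+1 - i.+2) + greedy_arity i.+1)%N by rewrite greedy_startS; lia.
  by rewrite iotaD; have -> : (i.+2 + (greedy_start i.+1 - i.+2) =
    greedy_start i.+1)%N by lia.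
have sz : size [seq s j | j <- rev (iota (greedy_start i.+1) (greedy_arity i.+1))] =
  greedy_arity i.+1.
  by rewrite size_map size_rev size_iota.
have hS b l : huffman x (b :: b0 :: bs) l = (\prod_(z <- take b l) (z + x)) *
    huffman x (b0 :: bs) (rcons (drop b l) (sigma x b l)) by [].
rewrite Eq Ebs hS -Ebs /sigma.
rewrite take_size_cat // drop_size_cat //.
rewrite !big_map !(perm_big _ (permEl (perm_rev (iota _ _)))) /=.
rewrite -sE //.
have -> : rcons [seq s j | j <- rev (iota i.+2 (greedy_start i.+1 - i.+2))] (s i.+1) =
   [seq s j | j <- rev (iota i.+1 (greedy_start i.+1 - i.+1))].
  have -> : (greedy_start i.+1 - i.+1 = (greedy_start i.+1 - i.+2).+1)%N by lia.
  by rewrite /= rev_cons map_rcons.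
rewrite IH ?(ltnW hi) // mulrCA; congr (_ * _).
have -> : (greedy_start i.+2 - 1 =
  (greedy_start i.+1 - 1) + greedy_arity i.+1)%N by rewrite greedy_startS; lia.
rewrite iotaD big_cat /= mulrC; congr (_ * _).
by have -> : (1 + (greedy_start i.+1 - 1) = greedy_start i.+1)%N by lia.
Qed.

Lemma sorted_geq_filter (t : seq nat) : sorted geq t ->
  let m := count (fun d => 1 < d)%N t in
  [seq d <- t | (1 < d)%N] = take m t /\ all (fun d => d <= 1)%N (drop m t).
Proof.
elim: t => //= d t IH dt.
have [h1 h2] := IH (path_sorted dt).
have [d1|d1] := ltnP 1 d; first by rewrite add1n /= h1.
have al : all (fun d' => d' <= 1)%N t.
  have tr : transitive geq by move=> a b c /= u v; exact: leq_trans v u.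
  by apply: sub_all (order_path_min tr dt) => a /= /leq_trans; apply.
have -> : count (fun d => 1 < d)%N t = 0%N.
  by apply/eqP; rewrite -leqn0 leqNgt -has_count -all_predC; apply: sub_all al => a /=;
    rewrite -leqNgt.
split; last by rewrite addn0 drop0 /= d1.
rewrite add0n take0; apply/eqP;
  rewrite -size_eq0 size_filter -leqn0 leqNgt -has_count -all_predC.
by apply: sub_all al => a /=; rewrite -leqNgt.
Qed.

(** The step lemma at [i = m], the number of internal vertices besides the root. All later vertices
    are childless, so the queue holds each of them with conductance [1]. *)
Lemma huffman_greedy :
  huffman x arities_of (nseq (count (pred1 1%N) (behead D)) 1) =
  s 0%N * \prod_(j <- iota 1 n.-1) (s j + x).
Proof.
pose m := (count (fun d => 1 < d)%N (behead D)).
have mn : (m < n)%N.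
  apply: leq_ltn_trans (count_size _ _) _.
  by rewrite size_behead -/n; case: n n_gt0.
have sD : sorted geq (behead D) by case: (D) D_sorted => //= d t /path_sorted.
have [fE aE] := sorted_geq_filter sD; rewrite -/m in fE aE.
have b0 j : (m < j < n)%N -> greedy_arity j = 0%N.
  move=> hj; have : (nth 0 D j <= 1)%N.
    have -> : nth 0%N D j = nth 0%N (drop m (behead D)) (j - m.+1).
      rewrite nth_drop nth_behead; congr nth; lia.
    apply: (allP aE); apply: mem_nth; rewrite size_drop size_behead -/n; lia.
  rewrite /greedy_arity (leq_ltn_trans (leq0n m)); lia.
have cm : greedy_start m.+1 = n.
  have h k : (m.+1 + k <= n)%N -> greedy_start (m.+1 + k) = greedy_start m.+1.
    elim: k => [|k IHk] hk; first by rewrite addn0.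
    by rewrite addnS greedy_startS IHk ?b0 ?addn0; lia.
  by have := h (n - m.+1)%N; rewrite subnKC // greedy_start_size => /(_ (leqnn _)).
have := huffman_greedy_step mn; rewrite cm subn1 => <-; congr huffman.
- rewrite /arities_of fE; congr (rev (_ :: _)).
  apply: (@eq_from_nth _ 0%N).
    by rewrite !size_map size_iota size_takel // size_behead -/n; lia.
  move=> i; rewrite size_map size_takel ?size_behead -/n; last by lia.
  move=> hi; rewrite !(nth_map 0%N) ?size_iota ?size_takel ?size_behead -/n //; try by lia.
  by rewrite nth_take // nth_behead nth_iota // /greedy_arity add1n subn1.
have cE : count (pred1 1%N) (behead D) = (n - m.+1)%N.
  have al : all (fun d => 0 < d)%N (behead D).
    apply/(all_nthP 0%N) => i; rewrite size_behead -/n nth_behead => hi.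
    by apply: D_pos; lia.
  have : (count (pred1 1%N) (behead D) + m = size (behead D))%N.
    rewrite /m; elim: (behead D) al => //= d t IHt /andP[d0 /IHt <-].
    by case: d d0 => [|[|d]] // _; rewrite /= ?add0n ?addnS ?addSn ?add1n.
  rewrite size_behead -/n; lia.
rewrite cE; apply: (@eq_from_nth _ 0).
  by rewrite size_nseq size_map size_rev size_iota.
move=> i; rewrite size_nseq => hi;
  rewrite nth_nseq hi (nth_map 0%N) ?size_rev ?size_iota //.
set j := nth _ _ _; have hj : (m < j < n)%N.
  have : j \in rev (iota m.+1 (n - m.+1)) by apply: mem_nth; rewrite size_rev size_iota.
  by rewrite mem_rev mem_iota; lia.
rewrite (ground_roseE greedy_parent_lt x); last by lia.
by rewrite -big_filter greedy_parent_kids ?b0 // ?big_nil ?addr0 //; lia.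
Qed.

End Huff.
End Greedy.

(** * From trees to parent arrays *)

Section Grow.
Variables (T : finType) (e : rel T).
Hypothesis e_tree : is_tree e.

(** Adds one adjacent vertex at a time. The last clause, connectedness by simple paths inside [s],
    is what forces a new vertex to have a single neighbour in [s]. *)
Lemma grow_seq (r : T) k : (0 < k <= #|T|)%N ->
  exists s : seq T, [/\ uniq s, size s = k, head r s = r,
    forall i, (0 < i < k)%N -> exists2 j, (j < i)%N &
      forall j', (j' < i)%N -> e (nth r s i) (nth r s j') = (j' == j) &
    forall u v, u \in s -> v \in s -> exists q,
      [/\ path e u q, last u q = v, uniq (u :: q) & {subset q <= s}]].
Proof.
case: e_tree => [[sym irr] _ conn acyc].
elim: k => // -[_ _|k IH /andP[_ hk]].
  exists [:: r]; split=> //; first by move=> i; lia.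
  by move=> u v; rewrite !inE => /eqP-> /eqP->; exists [::].
have [s [us ss hs par con]] := IH (ltnW hk).
have rs : r \in s by case: (s) hs ss => //= a s' -> _; rewrite mem_head.
(* If no edge left [s], connectedness would put all of [T] into [s]. *)
have [[a z] /= /and3P[az a_s zs]] : exists az : T * T, [&& e az.1 az.2,
  az.1 \in s & az.2 \notin s].
  apply/existsP; apply: contraPT hk => /existsPn h.
  suff : (#|T| <= size s)%N by rewrite ss => h1 h2; lia.
  rewrite -(card_uniqP us); apply/subset_leq_card/subsetP => w _.
  have cl : closed e (mem s).
    apply: intro_closed; first exact: sym_connect_sym.
    move=> u v uv us'; have := h (u, v); rewrite /= uv us' /= negbK //.
  by have := closed_connect cl (conn r w); rewrite /= rs => <-.
have za a' : a' \in s -> e z a' = (a' == a).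
  move=> a's; have [->|ne] := eqVneq a' a; first by rewrite sym.
  apply/negbTE/negP => ea'; have [q [pq lq uq qs]] := con a a' a_s a's.
  (* A second neighbour [a'] closes a cycle through [z], of length at least three since
     [a' != a]. *)
  apply: (acyc (z :: a :: q)).
    by case: q lq {pq uq qs} => [/= aa|//]; rewrite aa eqxx in ne.
  apply/andP; split.
    by rewrite /= sym az rcons_path pq lq sym.
  rewrite cons_uniq uq andbT inE negb_or.
  have zq : z \notin q by apply: contra zs => /qs.
  by rewrite zq andbT; apply: contraNneq zs => ->.
exists (rcons s z); split.
- by rewrite rcons_uniq zs.
- by rewrite size_rcons ss.
- by case: (s) hs ss.
- move=> i hi; have [ik|ik] := ltnP i k.+1.
    have [|j ji hj] := par i; first by rewrite ik andbT; case/andP: hi.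
    exists j => // j' j'i; rewrite !nth_rcons ss ik (ltn_trans j'i ik); exact: hj.
  have {ik hi} -> : i = k.+1 by lia.
  exists (index a s) => [|j' j'k]; first by rewrite -ss index_mem.
  rewrite !nth_rcons ss ltnn eqxx j'k za; last by rewrite mem_nth // ss.
  apply/eqP/eqP => [<-|->]; last by rewrite nth_index.
  by rewrite index_uniq // ss.
- have sub q : {subset q <= s} -> {subset q <= rcons s z}.
    by move=> h y /h; rewrite mem_rcons inE orbC => ->.
  move=> u v; rewrite !mem_rcons !inE => /orP[/eqP->|us'] /orP[/eqP->|vs'].
  + by exists [::].
  + have [q [pq lq uq qs]] := con a v a_s vs'.
    exists (a :: q); split=> //.
    * by rewrite /= sym az.
    * apply/andP; split; last exact: uq.
      rewrite inE negb_or.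
      have zq : z \notin q by apply: contra zs => /qs.
      by rewrite zq andbT; apply: contraNneq zs => ->.
    * apply: sub => y; rewrite inE => /orP[/eqP->//|]; exact: qs.
  + have [q [pq lq uq qs]] := con u a us' a_s.
    exists (rcons q z); split.
    * by rewrite rcons_path pq lq.
    * by rewrite last_rcons.
    * rewrite -/(uniq (u :: rcons q z)) -rcons_cons rcons_uniq.
      apply/andP; split; last exact: uq.
      rewrite inE negb_or.
      have zq : z \notin q by apply: contra zs => /qs.
      by rewrite zq andbT; apply: contraNneq zs => ->.
    * by move=> y; rewrite !mem_rcons !inE => /orP[->//|/qs->]; rewrite orbT.
  + have [q [pq lq uq qs]] := con u v us' vs'; exists q; split=> //; exact: sub.
Qed.

(** Vertices are numbered as [grow_seq] lists them, and [p i] is the place of the unique earlier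
    neighbour. *)
Lemma tree_parent (r : T) : exists (p : nat -> nat) (f : 'I_#|T| -> T),
  [/\ forall i, (0 < i < #|T|)%N -> (p i < i)%N, injective f,
      forall i : 'I_#|T|, i = 0%N :> nat -> f i = r &
      forall i j, e (f i) (f j) = pgraph p i j].
Proof.
have [[sym irr] T0 _ _] := e_tree.
have [|s [us ss hs par _]] := @grow_seq r #|T|; first by rewrite T0 leqnn.
pose p i := find (e (nth r s i)) s.
have pE i : (0 < i < #|T|)%N -> (p i < i)%N /\
    forall j, (j < i)%N -> e (nth r s i) (nth r s j) = (j == p i).
  move=> hi; have [j ji hj] := par i hi.
  have ej : e (nth r s i) (nth r s j) by rewrite hj.
  have pj : p i = j.
    apply/eqP; rewrite eqn_leq; apply/andP; split.
      by rewrite leqNgt; apply/negP => /(before_find r); rewrite ej.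
    rewrite leqNgt; apply/negP => lt.
    have := nth_find r (_ : has (e (nth r s i)) s).
    rewrite -/(p i) hj ?(ltn_trans lt) // (ltn_eqF lt).
    have -> // : has (e (nth r s i)) s; last by move=> /(_ isT).
    by apply/hasP; exists (nth r s j) => //; apply: mem_nth; rewrite ss; lia.
  by rewrite pj.
have plt i : (0 < i < #|T|)%N -> (p i < i)%N by case/pE.
exists p, (fun i : 'I_#|T| => nth r s i); split=> //.
- move=> i j /eqP; rewrite nth_uniq ?ss ?ltn_ord // => /eqP; exact: val_inj.
- by move=> i ->; rewrite nth0.
have half (i j : 'I_#|T|) : (j < i)%N -> e (nth r s i) (nth r s j) = pgraph p i j.
  move=> ji; have hi : (0 < i < #|T|)%N by rewrite (leq_ltn_trans _ ji) // ltn_ord.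
  have [_ ->//] := pE i hi; rewrite /pgraph (leq_ltn_trans _ ji) //= eq_sym.
  have -> : (0 < j)%N && (p j == i) = false; last by rewrite orbF.
  case: (posnP j) => //= j0; apply/negbTE; rewrite neq_ltn (ltn_trans (plt _ _) ji) //.
  by rewrite j0 ltn_ord.
move=> i j; have [ij|ji|/val_inj->] := ltngtP i j.
- by rewrite sym half // /pgraph orbC.
- exact: half.
- rewrite irr /pgraph orbb; case: (posnP j) => //= j0.
  by apply/esym/negbTE; rewrite neq_ltn plt // j0 ltn_ord.
Qed.

End Grow.

(** * Conversely, parent arrays define trees *)

Section PGraphTree.
Variables (n : nat) (p : nat -> nat).
Hypothesis n_gt0 : (0 < n)%N.
Hypothesis p_lt : forall i, (0 < i < n)%N -> (p i < i)%N.

Lemma pgraph_sym : symmetric (@pgraph n p).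
Proof. by move=> i j; rewrite /pgraph orbC. Qed.

Lemma pgraph_lt (i j : 'I_n) : pgraph p i j -> (j < i)%N -> j = p i :> nat.
Proof.
rewrite /pgraph => /orP[/andP[_ /eqP//]|/andP[j0 /eqP pj] ji].
have := p_lt (_ : (0 < j < n)%N); rewrite j0 ltn_ord pj => /(_ isT) h.
by have := ltn_trans h ji; rewrite ltnn.
Qed.

Lemma pgraph_tree : is_tree (@pgraph n p).
Proof.
have irr : irreflexive (@pgraph n p).
  move=> i; rewrite /pgraph orbb; case: (posnP i) => //= i0.
  by apply/negbTE; rewrite neq_ltn p_lt // i0 ltn_ord.
split=> //.
- by split=> //; exact: pgraph_sym.
- by rewrite card_ord.
- have c0 k (i : 'I_n) : i = k :> nat -> connect (pgraph p) i (Ordinal n_gt0).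
    elim/ltn_ind: k i => k IH i ik.
    have [i0|i0] := posnP i; first by rewrite (_ : i = Ordinal n_gt0) //; apply: val_inj.
    have pi : (p i < i)%N by rewrite p_lt // i0 ltn_ord.
    have pn := ltn_trans pi (ltn_ord i).
    apply: connect_trans (connect1 _) (IH _ _ (Ordinal pn) erefl); last by rewrite -ik.
    by rewrite /pgraph i0 eqxx.
  move=> x y; apply: connect_trans (c0 _ x erefl) _.
  by rewrite (sym_connect_sym pgraph_sym); exact: (c0 _ y erefl).
- move=> c c2 uc; have [m0 m0c] : exists m, m \in c by case: c c2 {uc} => // m c; exists m;
  rewrite mem_head.
  (* Both neighbours of the largest vertex [m] of a cycle are smaller, hence both equal [p m],
     although a cycle of length at least three has them distinct. *)
  pose m := [arg max_(i > m0 in c) (i : nat)].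
  have [mc hm] : m \in c /\ forall i, i \in c -> (i <= m)%N.
    by rewrite /m; case: arg_maxnP.
  have [k c' E] := rot_to mc.
  have uc' : ucycle (pgraph p) (m :: c') by rewrite -E rot_ucycle.
  have hc i : i \in c' -> (i <= m)%N.
    by move=> ic; apply: hm; rewrite -(mem_rot k) E inE ic orbT.
  have sc : (1 < size c')%N by move: c2; rewrite -(size_rot k) E.
  case/andP: uc' => /=.
  case: c' {E} hc sc => [//|a [//|b c']] hc _.
  rewrite /= rcons_path => /and3P[ma _ /andP[_ lm]] /and3P[mn an _].
  have lc : last b c' \in b :: c' by exact: mem_last.
  have lt i : i \in a :: b :: c' -> (i < m)%N.
    move=> ic; rewrite ltn_neqAle hc // andbT; apply: contraNneq mn => im.
    by rewrite -(_ : i = m) //; exact: val_inj.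
  have e1 := pgraph_lt ma (lt _ (mem_head _ _)).
  rewrite pgraph_sym in lm.
  have e2 : last b c' = p m :> nat by apply: pgraph_lt lm (lt _ _); rewrite inE lc orbT.
  by move: an; rewrite (_ : a = last b c') ?lc //; apply: val_inj; rewrite /= e1 e2.
Qed.

End PGraphTree.

(** * Spectra of symmetric and Gram matrices *)

Lemma char_poly_conj (F : fieldType) n (P A B : 'M[F]_n) :
  P \in unitmx -> P *m A = B *m P -> char_poly A = char_poly B.
Proof.
move=> uP PA; pose Q := map_mx polyC P.
have h : Q *m char_poly_mx A = char_poly_mx B *m Q.
  rewrite /char_poly_mx mulmxBr mulmxBl -!map_mxM PA; congr (_ - _).
  by rewrite mul_mx_scalar mul_scalar_mx.
have dQ : \det Q != 0.
  by rewrite det_map_mx polyC_eq0 -unitfE -unitmxE.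
have := congr1 determinant h; rewrite !det_mulmx mulrC.
by move/(mulIf dQ).
Qed.

Lemma map_prod_XsubC (F K : fieldType) (f : {rmorphism F -> K}) (s : seq F) :
  map_poly f (\prod_(z <- s) ('X - z%:P)) = \prod_(z <- s) ('X - (f z)%:P).
Proof.
by rewrite rmorph_prod; apply: eq_bigr => z _; rewrite rmorphB /= map_polyX map_polyC.
Qed.

Section Spectrum.
Variable R : realType.

(** The spectral theorem over [R[i]] diagonalises the matrix with real entries, and the
    factorisation descends along the embedding of [R]. *)
Lemma symmetric_char_poly n (A : 'M[R]_n) : A^T = A ->
  exists s : seq R, char_poly A = \prod_(z <- s) ('X - z%:P).
Proof.
move=> sA; pose f : {rmorphism R -> R[i]} := real_complex R.
pose B := map_mx f A.
have realB : B \is a mxOver Num.real.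
  by apply/mxOverP => i j; rewrite mxE; apply/complex_realP; exists (A i j).
have symB : B \is symmetricmx.
  by apply/is_hermitianmxP; rewrite expr0 scale1r map_mx_id //; apply/matrixP => i j;
    rewrite !mxE -[in LHS]sA mxE.
have hermB := realsym_hermsym symB realB.
have /mxOverP realD := hermitian_spectral_diag_real hermB.
have /orthomx_spectralP eB := hermitian_normalmx hermB.
set P := spectralmx B in eB; set d := spectral_diag B in eB realD.
have uP : P \in unitmx by exact: spectral_unit.
have cB : char_poly B = char_poly (diag_mx d).
  apply: (char_poly_conj uP).
  by rewrite {1}eB !mulmxA mulmxV // mul1mx.
have cD : char_poly (diag_mx d) = \prod_(i < n) ('X - (d 0 i)%:P).
  rewrite char_poly_trig; last by apply: is_diag_mx_is_trig; exact: diag_mx_is_diag.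
  by apply: eq_bigr => i _; rewrite mxE eqxx.
exists [seq complex.Re (d 0 i) | i <- enum 'I_n].
apply: (map_poly_inj f); rewrite map_char_poly -/B cB cD map_prod_XsubC big_map big_enum.
by apply: eq_bigr => i _; rewrite /= RRe_real.
Qed.

(** For an eigenvector [v], the squared norm of [v *m N] is [z] times that of [v]. *)
Lemma char_poly_gram_ge0 m k (N : 'M[R]_(m, k)) (s : seq R) :
  char_poly (N *m N^T) = \prod_(z <- s) ('X - z%:P) -> all (fun z => 0 <= z) s.
Proof.
move=> cs; apply/allP => z zs.
have : eigenvalue (N *m N^T) z by rewrite eigenvalue_root_char cs root_prod_XsubC.
move=> /eigenvalueP[v vz v0].
have e : ((v *m N) *m (v *m N)^T) 0 0 = z * ((v *m v^T) 0 0).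
  by rewrite trmx_mul -mulmxA [N *m _]mulmxA mulmxA vz -scalemxAl mxE.
have sq j (w : 'rV[R]_j) : (w *m w^T) 0 0 = \sum_i w 0 i ^+ 2.
  by rewrite mxE; apply: eq_bigr => i _; rewrite mxE expr2.
have v2 : 0 < (v *m v^T) 0 0.
  rewrite sq lt_neqAle sumr_ge0 ?andbT => [|i _]; last exact: sqr_ge0.
  apply: contraNneq v0 => /esym /eqP; rewrite psumr_eq0 => [|i _]; last exact: sqr_ge0.
  move=> /allP h; apply/eqP/rowP => i; rewrite mxE.
  by have := h i (mem_index_enum i); rewrite /= sqrf_eq0 => /eqP.
rewrite -(pmulr_lge0 _ v2) -e sq sumr_ge0 // => i _; exact: sqr_ge0.
Qed.

Lemma eigenvalues_perm n (A : 'M[R]_n) (s : seq R) :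
  char_poly A = \prod_(z <- s) ('X - z%:P) -> perm_eq (eigenvalues A) s.
Proof.
rewrite /eigenvalues => ->; set p := \prod_(z <- s) _.
have p0 : p != 0 by rewrite monic_neq0 // monic_prod_XsubC.
have rt z : (z \in rootsR p) = (z \in s).
  have := roots_onP (roots_on_rootsR p0) (x := z).
  by rewrite in_itv /= root_prod_XsubC => /(_ isT) ->.
have un : uniq (rootsR p) by exact: (sorted_uniq lt_trans ltxx (sorted_roots _ _ _)).
rewrite /perm_eq.
apply/allP => z _; apply/eqP => /=.
rewrite count_flatten -map_comp sumnE big_map.
rewrite (eq_bigr (fun y => (y == z) * count_mem y s)%N); last first.
  by move=> y _; rewrite /= count_nseq /= mu_prod_XsubC.
have [zs|zs] := boolP (z \in rootsR p).
  rewrite (bigD1_seq z) //= eqxx mul1n big1 ?addn0 // => y /negbTE -> //.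
rewrite big1_seq => [|y /andP[_ yr]].
  by apply/esym/eqP; rewrite -leqn0 leqNgt -has_count has_pred1 -rt.
by case: eqP => // yz; rewrite -yz yr in zs.
Qed.

(** Evaluates the characteristic polynomial at [- x^-1]. *)
Lemma det_char_poly n (A : 'M[R]_n) (s : seq R) x : x != 0 ->
  char_poly A = \prod_(z <- s) ('X - z%:P) ->
  \det (1%:M + x *: A) = \prod_(z <- s) (1 + x * z).
Proof.
move=> x0 cs.
have sz : size s = n.
  have := size_char_poly A; rewrite cs size_prod_XsubC => -[] //.
have h : (char_poly A).[- x^-1] = \det ((- x^-1)%:M - A).
  rewrite /char_poly -horner_evalE -det_map_mx; congr (\det _).
  apply/matrixP => i j; rewrite !mxE rmorphB rmorphMn /= /horner_eval hornerX hornerC.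
  by [].
have -> : 1%:M + x *: A = (- x) *: ((- x^-1)%:M - A).
  by rewrite scalerBr scale_scalar_mx mulrNN divff // scaleNr opprK.
have -> : \prod_(z <- s) (1 + x * z) = \prod_(z <- s) (- x * (- x^-1 - z)).
  by apply: eq_bigr => z _; rewrite mulrBr mulrNN divff // mulNr opprK.
rewrite detZ -h cs horner_prod -sz big_split /= big_const_seq count_predT.
rewrite iter_mulr_1; congr (_ * _).
by apply: eq_bigr => z _; rewrite hornerXsubC.
Qed.

End Spectrum.

(** * Incidence matrix and Laplacian of a tree *)

Section Incidence.
Variables (R : realType) (T : finType) (e : rel T).
Hypothesis e_simple : simple_graph e.

Lemma edge_set_in x y : e x y -> [set x; y] \in edge_set e.
Proof.
by move=> exy; rewrite inE; apply/existsP; exists x; apply/existsP; exists y;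
  rewrite exy eqxx.
Qed.

Lemma edge_setP A u v : A \in edge_set e -> u \in A -> v \in A -> u != v ->
  e u v /\ A = [set u; v].
Proof.
case: e_simple => sym irr.
rewrite inE => /existsP[x /existsP[y /andP[exy /eqP->]]].
rewrite !inE => /orP[/eqP->|/eqP->] /orP[/eqP->|/eqP->]; rewrite ?eqxx // => _.
by rewrite sym exy setUC.
Qed.

(** Distinct [u] and [v] lie together only in the edge [[set u; v]]; the edges at [u] correspond to
    its neighbours. *)
Lemma sum_edges (u v : T) :
  (\sum_(A in edge_set e) ((u \in A) && (v \in A)) =
   degree e u * (u == v) + e u v)%N.
Proof.
have [sym irr] := e_simple.
have [<-|neq] := eqVneq u v; last first.
  rewrite muln0 add0n; have [euv|neuv] := boolP (e u v); last first.
    rewrite big1 // => A hA; case: andP => // -[uA vA].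
    by have [euv] := edge_setP hA uA vA neq; rewrite euv in neuv.
  rewrite (bigD1 [set u; v]) ?edge_set_in //= !inE !eqxx orbT /= big1 // => A /andP[hA ne].
  case: andP => // -[uA vA]; have [_ E] := edge_setP hA uA vA neq.
  by rewrite E eqxx in ne.
rewrite muln1 irr addn0.
under eq_bigr do rewrite andbb.
rewrite -big_mkcondr sum1_card /degree.
have <- : #|[set [set u; y] | y in [set y | e u y]]| = #|[set y | e u y]|.
  apply: card_in_imset => y z; rewrite !inE => uy uz /setP/(_ y).
  rewrite !inE eqxx orbT => /esym/orP[/eqP yu|/eqP//].
  by rewrite yu irr in uy.
apply: eq_card => A; apply/andP/imsetP => [[hA uA]|[y]].
  move: hA; rewrite inE => /existsP[x /existsP[y /andP[exy /eqP E]]].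
  move: uA; rewrite E !inE => /orP[/eqP->|/eqP->].
    by exists y; rewrite ?inE.
  by exists x; rewrite ?inE 1?sym // setUC.
rewrite inE => uy ->; split; last by rewrite !inE eqxx.
exact: edge_set_in.
Qed.

Lemma gram_incidence : incidence_mx e R *m (incidence_mx e R)^T =
  degree_mx e R + adjacency_mx e R.
Proof.
apply/matrixP => i j; rewrite !mxE.
have -> : (degree e (enum_val i))%:R *+ (i == j) + (e (enum_val i) (enum_val j))%:R =
    (degree e (enum_val i) * (enum_val i == enum_val j) +
      e (enum_val i) (enum_val j))%:R :> R.
  by rewrite natrD natrM mulr_natr (inj_eq enum_val_inj).
rewrite -sum_edges.
rewrite natr_sum [RHS]big_enum_val; apply: eq_bigr => k _.
by rewrite !mxE -mulnb natrM.
Qed.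

(** Conjugation by the diagonal matrix of signs of a proper 2-colouring flips exactly the adjacency
    entries. *)
Lemma gram_laplacian (c : T -> bool) : (forall u v, e u v -> c u != c v) ->
  char_poly (incidence_mx e R *m (incidence_mx e R)^T) = char_poly (laplacian_mx e R).
Proof.
move=> hc; pose d : 'rV[R]_#|T| := \row_i (-1) ^+ c (enum_val i).
apply: (@char_poly_conj _ _ (diag_mx d)).
  rewrite unitmxE det_diag unitfE; apply/prodf_neq0 => i _.
  by rewrite mxE signr_eq0.
rewrite gram_incidence; apply/matrixP => i j.
rewrite mul_diag_mx mul_mx_diag !mxE.
have [<-|ij] := eqVneq i j.
  by have [_ ->] := e_simple; rewrite addr0 subr0 mulrC.
rewrite !mulr0n add0r sub0r.
case E : (e _ _); last by rewrite mulr0 oppr0 mul0r.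
rewrite mulr1 mulN1r; have := hc _ _ E.
by case: (c _); case: (c _) => //= _; rewrite ?expr0 ?expr1 ?opprK.
Qed.

Lemma bipartite_spectrum (c : T -> bool) : (forall u v, e u v -> c u != c v) ->
  exists s : seq R, [/\ all (fun z => 0 <= z) s,
    incidence_energy R e = \sum_(z <- s) Num.sqrt z,
    laplacian_energy_like R e = \sum_(z <- s) Num.sqrt z &
    forall x, x != 0 -> \det (1%:M + x *: laplacian_mx e R) = \prod_(z <- s) (1 + x * z)].
Proof.
move=> hc; have [|s cs] := @symmetric_char_poly R _ (incidence_mx e R *m (incidence_mx e
  R)^T).
  by rewrite trmx_mul trmxK.
have cl := cs; rewrite (gram_laplacian hc) in cl.
exists s; split.
- exact: char_poly_gram_ge0 cs.
- by rewrite /incidence_energy /singular_values big_map (perm_big _ (eigenvalues_perm cs)).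
- by rewrite /laplacian_energy_like (perm_big _ (eigenvalues_perm cl)).
- by move=> x x0; rewrite (det_char_poly x0 cl).
Qed.

End Incidence.

(** Rows and columns undergo the same permutation, so the two signs cancel. *)
Lemma det_reindex (K : comNzRingType) (T : finType) n (f : 'I_n -> T) (F : T -> T -> K) :
  #|T| = n -> injective f ->
  \det (\matrix_(i < #|T|, j < #|T|) F (enum_val i) (enum_val j)) =
  \det (\matrix_(i < n, j < n) F (f i) (f j)).
Proof.
move=> en; case: n / en f => f fI.
have gI : injective (fun i => enum_rank (f i)) by move=> i j /enum_rank_inj /fI.
pose s := perm gI.
set A := \matrix_(i, j) F (enum_val i) _.
have -> : \matrix_(i, j) F (f i) (f j) = row_perm s (col_perm s A).
  by apply/matrixP => i j; rewrite !mxE !permE !enum_rankK.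
by rewrite row_permE col_permE !det_mulmx !det_perm odd_permV mulrCA -signr_addb addbb
  mulr1.
Qed.

Section TreeSpectrum.
Variables (R : realType) (T : finType) (e : rel T) (p : nat -> nat) (n : nat) (f : 'I_n ->
  T).
Hypotheses (Tn : #|T| = n) (f_inj : injective f).
Hypothesis p_lt : forall i, (0 < i < n)%N -> (p i < i)%N.
Hypothesis ef : forall i j, e (f i) (f j) = pgraph p i j.

Lemma iso_onto u : exists i, u = f i.
Proof.
have fb : bijective f by apply: inj_card_bij => //; rewrite card_ord Tn.
by case: fb => g _ gK; exists (g u).
Qed.

Lemma degree_iso i : degree e (f i) = degree (pgraph p) i.
Proof.
rewrite /degree -(card_imset _ f_inj); apply: eq_card => u.
have [j ->] := iso_onto u; rewrite inE ef; apply/idP/imsetP => [h|[k]].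
  by exists j; rewrite ?inE.
by rewrite inE => h /f_inj ->.
Qed.

Lemma pgraph_coloring : exists c : nat -> bool, forall i, (0 < i < n)%N -> c i != c (p i).
Proof.
suff [c hc] : exists c : nat -> bool, forall i, (i < n)%N -> (0 < i)%N -> c i != c (p i).
  by exists c => i /andP[i0 h]; exact: hc.
elim: {-2}n (leqnn n) => [|k IH] kn; first by exists xpred0.
have [c hc] := IH (ltnW kn).
exists (fun j => if j == k then ~~ c (p k) else c j) => i hi i0.
have pi : (p i < i)%N by rewrite p_lt // i0 (leq_trans hi kn).
have [->|ne] := eqVneq i k.
  by rewrite (ltn_eqF (_ : p k < k)%N) ?p_lt ?kn ?andbT; [case: (c _)|lia..].
by rewrite (ltn_eqF (_ : p i < k)%N) ?hc //; lia.
Qed.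

Lemma tree_spectrum : simple_graph e ->
  exists s : seq R, [/\ all (fun z => 0 <= z) s,
    incidence_energy R e = \sum_(z <- s) Num.sqrt z,
    laplacian_energy_like R e = \sum_(z <- s) Num.sqrt z &
    forall x, 0 < x -> \prod_(z <- s) (1 + x * z) =
    \det (\matrix_(i < n, j < n) ((i == j)%:R + x * ((degree (pgraph p) i)%:R *+ (i == j)
     - (pgraph p i j)%:R)))].
Proof.
move=> es; have [c hc] := pgraph_coloring.
(* The colour of [u] is read off at its number; as [f] is onto, the default [0] is never taken. *)
have [u v euv|s [s0 h1 h2 h3]] := @bipartite_spectrum R T e es
   (fun u => c (if [pick i | u == f i] is Some i then i : nat else 0%N)).
  have fE i : (if [pick j | f i == f j] is Some i' then i' : nat else 0%N) = i.
    case: pickP => [j /eqP /f_inj -> //|/(_ i)]; by rewrite eqxx.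
  have [i ui] := iso_onto u; have [j vj] := iso_onto v.
  move: euv; rewrite ui vj !fE ef /pgraph => /orP[/andP[i0 /eqP <-]|/andP[j0 /eqP <-]].
    by apply: hc; rewrite i0 ltn_ord.
  by rewrite eq_sym; apply: hc; rewrite j0 ltn_ord.
exists s; split=> // x x0; rewrite -h3 ?gt_eqF //.
pose F (u v : T) : R := (u == v)%:R + x * ((degree e u)%:R *+ (u == v) - (e u v)%:R).
transitivity (\det (\matrix_(i < #|T|, j < #|T|) F (enum_val i) (enum_val j))).
  congr (\det _); apply/matrixP => i j; rewrite !mxE /F.
  by rewrite (inj_eq enum_val_inj).
rewrite (det_reindex F Tn f_inj); congr (\det _); apply/matrixP => i j.
by rewrite !mxE /F ef degree_iso (inj_eq f_inj).
Qed.

End TreeSpectrum.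

(** * Comparing sums of square roots *)

Section SqrtSum.
Variable R : realType.

Section Window.
Variable h : R.
Hypothesis h_gt0 : 0 < h.

(* Summed over all [k], [log_weight y k] is, up to the factor [4 * h], a Riemann sum
   for the integral of [expR (- u / 2) * ln (1 + expR (u + y))]; shifting [y] by [4 * h * j]
   multiplies it by [expR (2 * h * j)], so it is nearly proportional to [expR (y / 2)]. *)
Definition log_weight (y : R) (k : int) : R :=
  expR (- (2 * h * k%:~R)) * ln (1 + expR (4 * h * k%:~R + y)).
Definition window y (a : int) n : R := \sum_(i < n) log_weight y (a + i%:Z).

Lemma log_weight_ge0 y k : 0 <= log_weight y k.
Proof. by rewrite mulr_ge0 ?expR_ge0 // ln_ge0 // lerDl expR_ge0. Qed.

Lemma ln1p_mono (a b : R) : 0 <= a -> a <= b -> ln (1 + a) <= ln (1 + b).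
Proof.
move=> a0 ab; rewrite ler_ln ?lerD2l // posrE; [lra|].
by have := le_trans a0 ab; lra.
Qed.

Lemma log_weight_mono y y' k : y <= y' -> log_weight y k <= log_weight y' k.
Proof.
move=> yy; rewrite ler_wpM2l ?expR_ge0 // ln1p_mono ?expR_ge0 //.
by rewrite ler_expR lerD2l.
Qed.

Lemma log_weight_shift y (j k : int) :
  log_weight (y + 4 * h * j%:~R) k = expR (2 * h * j%:~R) * log_weight y (k + j).
Proof.
rewrite /log_weight intrD mulrA -expRD; congr (expR _ * ln (1 + expR _)); ring.
Qed.

Lemma window_shift y (j a : int) n :
  window (y + 4 * h * j%:~R) a n = expR (2 * h * j%:~R) * window y (a + j) n.
Proof.
rewrite /window mulr_sumr; apply: eq_bigr => i _.
by rewrite log_weight_shift addrAC.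
Qed.

Lemma window_mono y y' a n : y <= y' -> window y a n <= window y' a n.
Proof. by move=> yy; apply: ler_sum => i _; exact: log_weight_mono. Qed.

Lemma window_ge0 y a n : 0 <= window y a n.
Proof. by apply: sumr_ge0 => i _; exact: log_weight_ge0. Qed.

Lemma window_sub y (a a' : int) (n n' : nat) :
  a <= a' -> a' + n'%:Z <= a + n%:Z -> window y a' n' <= window y a n.
Proof.
move=> h1 h2.
have [p hp] : exists p : nat, a' = a + p%:Z by exists `|a' - a|%N; lia.
have [q hq] : exists q : nat, n = (p + (n' + q))%N.
  by exists (n - p - n')%N; lia.
rewrite /window hq big_split_ord /= big_split_ord /=.
have -> : \sum_(i < n') log_weight y (a + (p + i)%N%:Z) =
  \sum_(i < n') log_weight y (a' + i%:Z).
  by apply: eq_bigr => i _; rewrite hp PoszD addrA.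
apply: ler_wpDl; first by apply: sumr_ge0 => i _; exact: log_weight_ge0.
by apply: ler_wpDr => //; apply: sumr_ge0 => i _; exact: log_weight_ge0.
Qed.

(** With [v = expR (h * k)] the prefactor is [v^-2], and
    [ln (1 + v^4) <= 4 * ln (1 + v) <= 4 * v]. *)
Lemma log_weight0_pos_le (k : nat) : log_weight 0 k <= 4 * expR (- h) ^+ k.
Proof.
rewrite /log_weight addr0; set v := expR (h * k%:R).
have v0 : 0 < v by exact: expR_gt0.
have e4 : expR (4 * h * k%:~R) = v ^+ 4.
  by rewrite /v -expRM_natl; congr expR; rewrite -pmulrn; ring.
have e2 : expR (- (2 * h * k%:~R)) = v^-1 ^+ 2.
  by rewrite /v -expRN -expRM_natl; congr expR; rewrite -pmulrn; ring.
have e1 : expR (- h) ^+ k = v^-1.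
  by rewrite /v -expRN -expRM_natl; congr expR; ring.
rewrite e4 e2 e1.
have l1 : ln (1 + v ^+ 4) <= 4 * v.
  apply: (@le_trans _ _ (ln ((1 + v) ^+ 4))).
    rewrite ler_ln ?posrE ?exprn_gt0 ?addr_gt0 ?exprn_gt0 // -subr_ge0.
    have -> : (1 + v) ^+ 4 - (1 + v ^+ 4) = 4 * v + 6 * v ^+ 2 + 4 * v ^+ 3 by ring.
    by rewrite !addr_ge0 // mulr_ge0 // ?exprn_ge0 // ltW.
  rewrite lnXn ?addr_gt0 // -[leLHS]mulr_natl ler_wpM2l // le_ln1Dx //.
  by rewrite (lt_trans _ v0) // ltrN10.
apply: le_trans (ler_wpM2l _ l1) _; first by rewrite exprn_ge0 // invr_ge0 ltW.
rewrite le_eqVlt; apply/orP; left; apply/eqP; field; exact: lt0r_neq0.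
Qed.

Lemma log_weight0_neg_le (k : nat) : log_weight 0 (- k%:Z) <= 4 * expR (- h) ^+ k.
Proof.
rewrite /log_weight addr0; set v := expR (- h) ^+ k.
have v0 : 0 < v by rewrite exprn_gt0 // expR_gt0.
have v1 : v <= 1 by rewrite exprn_ile1 ?expR_ge0 // expR_le1 oppr_le0 ltW.
have e4 : expR (4 * h * (- k%:Z)%:~R) = v ^+ 4.
  by rewrite /v -exprM -expRM_natl; congr expR; rewrite mulrNz -pmulrn natrM; ring.
have e2 : expR (- (2 * h * (- k%:Z)%:~R)) = v^-1 ^+ 2.
  by rewrite /v -exprVn -expRN opprK -exprM -expRM_natl; congr expR;
    rewrite mulrNz -pmulrn natrM; ring.
rewrite e4 e2.
have l1 : ln (1 + v ^+ 4) <= v ^+ 4.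
  by apply: le_ln1Dx; rewrite (lt_trans _ (exprn_gt0 4 v0)) // ltrN10.
apply: le_trans (ler_wpM2l _ l1) _; first by rewrite exprn_ge0 // invr_ge0 ltW.
have -> : v^-1 ^+ 2 * v ^+ 4 = v * v by field; exact: lt0r_neq0.
by apply: ler_pM => //; rewrite ?ltW //; lra.
Qed.

Definition center M := window 0 (- M%:Z) (M + M).

(** Each step adds the indices [- M.+1] and [M], contributing at most [4 * expR (- h) ^+ M] each. *)
Lemma center_le M : center M <= 8 * \sum_(i < M) expR (- h) ^+ i.
Proof.
elim: M => [|M IH]; first by rewrite /center /window !big_ord0 mulr0.
have -> : center M.+1 = log_weight 0 (- M.+1%:Z) + center M + log_weight 0 M.
  rewrite /center /window addSn addnS big_ord_recr big_ord_recl /=.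
  rewrite addr0; congr (_ + _ + log_weight 0 _); last by lia.
  by apply: eq_bigr => i _; congr (log_weight 0 _); rewrite /bump; lia.
rewrite big_ord_recr /= mulrDr.
have := log_weight0_pos_le M; have := log_weight0_neg_le M.+1.
have : expR (- h) ^+ M.+1 <= expR (- h) ^+ M.
  by rewrite exprS ler_piMl ?exprn_ge0 ?expR_ge0 // expR_le1 oppr_le0 ltW.
lra.
Qed.

Lemma center_bounded : exists B, forall M, center M <= B.
Proof.
have q1 : expR (- h) < 1 by rewrite expR_lt1 oppr_lt0.
exists (8 * (1 - expR (- h))^-1) => M; apply: le_trans (center_le M) _.
rewrite ler_pM2l // -(ler_pM2l (_ : 0 < 1 - expR (- h))) ?subr_gt0 //.
rewrite mulfV ?gt_eqF ?subr_gt0 //.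
have := subrX1 (expR (- h)) M; have := exprn_ge0 M (expR_ge0 (- h)).
by move=> a b; rewrite -opprB mulNr -b opprB lerBlDr lerDl.
Qed.

(** For [z > 0] this is [log_weight (ln z) k]; unlike the latter it vanishes at [z = 0], as the
    eigenvalue [0] requires. *)
Definition weight (z : R) (k : int) : R :=
  expR (- (2 * h * k%:~R)) * ln (1 + expR (4 * h * k%:~R) * z).
Definition log_scale (z : R) : int := Num.floor (ln z / (4 * h)).

Lemma weightE z k : 0 < z -> weight z k = log_weight (ln z) k.
Proof. by move=> z0; rewrite /weight /log_weight expRD lnK. Qed.

Lemma log_scaleP z : 4 * h * (log_scale z)%:~R <= ln z <= 4 * h * (log_scale z + 1)%:~R.
Proof.
have h4 : 0 < 4 * h by rewrite mulr_gt0.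
have /andP[h1 h2] := floor_itv (ln z / (4 * h)).
by move: h1 h2; rewrite ler_pdivlMr // ltr_pdivrMr // ![_ * (4 * h)]mulrC => -> /ltW.
Qed.

Lemma sqrt_expR (z : R) : 0 < z -> Num.sqrt z = expR (ln z / 2).
Proof.
move=> z0; rewrite -{1}(lnK (x := z)) ?posrE //.
have -> : ln z = 2%:R * (ln z / 2) by field.
by rewrite expRM_natl sqrtr_sqr ger0_norm ?expR_ge0 //; congr expR; field.
Qed.

(** Rounding [ln z] down to the grid of step [4 * h] costs a factor of at most [expR (2 * h)] in
    [Num.sqrt z]; [weight_upper] rounds up at the same cost. *)
Lemma weight_lower z a n : 0 <= z ->
  Num.sqrt z * window 0 (a + log_scale z) n <=
    expR (2 * h) * \sum_(i < n) weight z (a + i%:Z).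
Proof.
rewrite le_eqVlt => /orP[/eqP <-|z0].
  rewrite sqrtr0 mul0r mulr_ge0 ?expR_ge0 // sumr_ge0 // => i _.
  by rewrite /weight mulr0 addr0 ln1 mulr0.
have /andP[h1 h2] := log_scaleP z.
have -> : \sum_(i < n) weight z (a + i%:Z) = window (ln z) a n.
  by apply: eq_bigr => i _; rewrite weightE.
apply: (@le_trans _ _ (expR (2 * h) * window (0 + 4 * h * (log_scale z)%:~R) a n));
  last first.
  by rewrite ler_wpM2l ?expR_ge0 // window_mono // add0r.
rewrite window_shift mulrA ler_wpM2r ?window_ge0 // -expRD sqrt_expR // ler_expR.
by move: h2; rewrite intrD; lra.
Qed.

Lemma weight_upper z a n : 0 <= z ->
  \sum_(i < n) weight z (a + i%:Z) <=
    expR (2 * h) * Num.sqrt z * window 0 (a + log_scale z + 1) n.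
Proof.
rewrite le_eqVlt => /orP[/eqP <-|z0].
  by rewrite sqrtr0 mulr0 mul0r sumr_le0 // => i _; rewrite /weight mulr0 addr0 ln1 mulr0.
have /andP[h1 h2] := log_scaleP z.
have -> : \sum_(i < n) weight z (a + i%:Z) = window (ln z) a n.
  by apply: eq_bigr => i _; rewrite weightE.
apply: (@le_trans _ _ (window (0 + 4 * h * (log_scale z + 1)%:~R) a n)).
  by rewrite window_mono // add0r.
rewrite window_shift addrA ler_wpM2r ?window_ge0 // sqrt_expR // -expRD ler_expR.
by move: h1; rewrite intrD; lra.
Qed.

Lemma ln_prod (s : seq R) x : 0 < x -> all (fun z => 0 <= z) s ->
  ln (\prod_(z <- s) (1 + x * z)) = \sum_(z <- s) ln (1 + x * z).
Proof.
move=> x0; elim: s => [|z s IH] /=; first by rewrite !big_nil ln1.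
move=> /andP[z0 s0]; rewrite !big_cons lnM ?IH // posrE.
  by rewrite ltr_wpDr // mulr_ge0 // ltW.
rewrite big_seq prodr_gt0 // => y cond_sum; rewrite ltr_wpDr // mulr_ge0 ?(ltW x0) //.
exact: (allP s0).
Qed.

(** Sums the logarithms of the hypothesis over the points [x = expR (4 * h * k)] of a window. The
    two rounding errors of [expR (2 * h)] make up the factor. *)
Lemma sqrt_sum_expR (s t : seq R) :
  all (fun z => 0 <= z) s -> all (fun z => 0 <= z) t ->
  (forall x, 0 < x -> \prod_(z <- s) (1 + x * z) <= \prod_(z <- t) (1 + x * z)) ->
  \sum_(z <- s) Num.sqrt z <= expR (4 * h) * \sum_(z <- t) Num.sqrt z.
Proof.
move=> s0 t0 hst.
have [B hB] := center_bounded.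
pose A := sup (fun y => exists M, y = center M).
have cA M : center M <= A.
  apply: ub_le_sup; last by exists M.
  by exists B => _ [M' ->].
have A0 : 0 < A.
  apply: lt_le_trans (cA 1%N); rewrite /center /window big_ord_recl ltr_pwDl //.
    by rewrite /log_weight mulr_gt0 ?expR_gt0 // ln_gt0 // ltrDl expR_gt0.
  by apply: sumr_ge0 => i _; exact: log_weight_ge0.
pose J := (\max_(z <- s ++ t) `|log_scale z|)%N.
have hJ z : z \in s ++ t -> (`|log_scale z| <= J)%N.
  by move=> zin; rewrite /J; apply: leq_bigmax_seq.
set X := \sum_(z <- s) _; set Y := \sum_(z <- t) _.
have Y0 : 0 <= Y by apply: sumr_ge0 => z _; exact: sqrtr_ge0.
have X0 : 0 <= X by apply: sumr_ge0 => z _; exact: sqrtr_ge0.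
have key M : X * center M <= expR (4 * h) * Y * A.
  (* A margin of [J] on both sides: after a shift by any [log_scale z] the window still covers
     [center M], and after a shift by one more it lies in [center (M + J + J + 1)]. *)
  pose a : int := - (M + J)%N%:Z; pose n := (M + J + (M + J))%N.
  have hs : X * center M <= expR (2 * h) * \sum_(z <- s) \sum_(i < n) weight z (a + i%:Z).
    rewrite /X mulr_suml mulr_sumr big_seq [leRHS]big_seq; apply: ler_sum => z zs.
    apply: le_trans (weight_lower _ _ (allP s0 _ zs)); rewrite ler_wpM2l ?sqrtr_ge0 //.
    have := hJ z; rewrite mem_cat zs => /(_ isT) hz.
    by apply: window_sub; rewrite /a /n; lia.
  have ht : \sum_(z <- t) \sum_(i < n) weight z (a + i%:Z) <= expR (2 * h) * Y * A.
    rewrite /Y mulr_sumr mulr_suml big_seq [leRHS]big_seq; apply: ler_sum => z zt.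
    apply: le_trans (weight_upper _ _ (allP t0 _ zt)) _.
    rewrite ler_wpM2l ?mulr_ge0 ?expR_ge0 ?sqrtr_ge0 //.
    apply: le_trans (cA (M + J + J + 1)%N).
    have := hJ z; rewrite mem_cat zt orbT => /(_ isT) hz.
    by apply: window_sub; rewrite /a /n; lia.
  apply: le_trans hs _.
  have -> : expR (4 * h) = expR (2 * h) * expR (2 * h) by rewrite -expRD; congr expR; ring.
  rewrite -!mulrA ler_wpM2l ?expR_ge0 // mulrA; apply: le_trans ht.
  rewrite exchange_big [leRHS]exchange_big /=; apply: ler_sum => i _.
  rewrite /weight -!mulr_sumr ler_wpM2l ?expR_ge0 // -!ln_prod ?expR_gt0 //.
  rewrite ler_ln ?hst ?expR_gt0 // posrE big_seq prodr_gt0 // => z zs.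
    by rewrite ltr_wpDr // mulr_ge0 ?expR_ge0 // (allP s0).
  by rewrite ltr_wpDr // mulr_ge0 ?expR_ge0 // (allP t0).
have [->|Xn] := eqVneq X 0; first by rewrite mulr_ge0 ?expR_ge0.
have Xp : 0 < X by rewrite lt_neqAle eq_sym Xn.
(* After division by [X] the goal is an upper bound for the supremum [A], which [key] gives for
   every [center M]. *)
rewrite -(ler_pM2r A0) mulrC -ler_pdivlMr //.
apply: ge_sup; first by exists (center 0), 0%N.
by move=> _ [M ->]; rewrite ler_pdivlMr // mulrC.
Qed.

End Window.

Theorem sqrt_sum_le (s t : seq R) :
  all (fun z => 0 <= z) s -> all (fun z => 0 <= z) t ->
  (forall x, 0 < x -> \prod_(z <- s) (1 + x * z) <= \prod_(z <- t) (1 + x * z)) ->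
  \sum_(z <- s) Num.sqrt z <= \sum_(z <- t) Num.sqrt z.
Proof.
move=> s0 t0 hst; rewrite leNgt; apply/negP.
set X := \sum_(z <- s) _; set Y := \sum_(z <- t) _ => YX.
have hh h : 0 < h -> X <= expR (4 * h) * Y.
  by move=> h0; exact: sqrt_sum_expR.
have Y0 : 0 <= Y by apply: sumr_ge0 => z _; exact: sqrtr_ge0.
have [Y00|Yn] := eqVneq Y 0.
  by have := hh 1 ltr01; rewrite Y00 mulr0 => h1; rewrite Y00 ltNge h1 in YX.
have Yp : 0 < Y by rewrite lt_neqAle eq_sym Yn.
have XY : 1 < X / Y by rewrite ltr_pdivlMr // mul1r.
have l0 : 0 < ln (X / Y) by rewrite ln_gt0.
(* This [h] makes [expR (4 * h)] the square root of [X / Y], which is smaller than [X / Y]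
   itself. *)
have := hh (ln (X / Y) / 8); rewrite divr_gt0 // => /(_ isT).
rewrite -ler_pdivrMr // -{1}(lnK (x := X / Y)) ?posrE; last by rewrite (lt_trans _ XY).
by rewrite ler_expR; lra.
Qed.

End SqrtSum.

(** * Degree sequences of trees and the main result *)

Section TreeData.
Variables (T : finType) (e : rel T) (D : seq nat).
Hypotheses (e_tree : is_tree e) (eD : degree_sequence e = D).

Lemma geq_trans : transitive geq.
Proof. by move=> a b c /= h1 h2; exact: leq_trans h2 h1. Qed.

Lemma degree_sequence_sorted : sorted geq D.
Proof. by rewrite -eD; apply: sort_sorted => a b; exact: leq_total. Qed.

Lemma degree_sequence_perm : perm_eq [seq degree e u | u <- enum T] D.
Proof. by rewrite -eD perm_sym; apply/permPl/perm_sort. Qed.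

Lemma size_degree_sequence : size D = #|T|.
Proof. by rewrite -(perm_size degree_sequence_perm) size_map -cardE. Qed.

(* Rooting at a vertex of largest degree. *)
Lemma tree_data : exists (p : nat -> nat) (f : 'I_#|T| -> T),
  [/\ forall i, (0 < i < #|T|)%N -> (p i < i)%N, injective f,
      forall i j, e (f i) (f j) = pgraph p i j,
      nkids #|T| p 0 = head 0%N D &
      perm_eq [seq (nkids #|T| p i).+1 | i <- iota 1 #|T|.-1] (behead D)].
Proof.
have [_ T0 _ _] := e_tree.
have [r hr] : exists r, degree e r = head 0%N D.
  have : head 0%N D \in D.
    have := size_degree_sequence; case: (D) => [|d D'] /= sz; last exact: mem_head.
    by rewrite -sz in T0.
  by rewrite -(perm_mem degree_sequence_perm) => /mapP[r _ ->]; exists r.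
have [p [f [plt fI f0 ef]]] := tree_parent e_tree r.
exists p, f; have dE i : degree e (f i) = ((0 < i) + nkids #|T| p i)%N.
  by rewrite (degree_iso erefl fI ef) degree_pgraph.
have n0 : nkids #|T| p 0 = head 0%N D.
  by rewrite -hr -(f0 (Ordinal T0) erefl) dE.
split=> //.
have pf : perm_eq [seq ((0 < i) + nkids #|T| p i)%N | i <- iota 0 #|T|] D.
  apply: perm_trans degree_sequence_perm.
  have -> : [seq ((0 < i) + nkids #|T| p i)%N | i <- iota 0 #|T|] =
      [seq degree e u | u <- [seq f i | i <- enum 'I_#|T|]].
    by rewrite -val_enum_ord -!map_comp; apply: eq_map => i /=; rewrite dE.
  apply: perm_map; apply: uniq_perm; rewrite ?enum_uniq ?(map_inj_uniq fI) ?enum_uniq //.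
  move=> u; rewrite mem_enum; have [i ->] := iso_onto erefl fI u.
  by rewrite map_f // mem_enum.
rewrite -(perm_cons (head 0%N D)).
have -> : head 0%N D :: behead D = D.
  have := size_degree_sequence; case: (D) => [|d D'] //= sz.
  by rewrite -sz in T0.
apply: perm_trans pf; rewrite (iota_n T0) /= n0 perm_cons.
rewrite (_ : [seq _ | i <- _] = [seq ((0 < i) +
  nkids #|T| p i)%N | i <- iota 1 #|T|.-1]) //.
by apply/eq_in_map => i; rewrite mem_iota => /andP[-> _]; rewrite add1n.
Qed.

Lemma degree_sequence_gt0 i : (0 < i < size D)%N -> (0 < nth 0 D i)%N.
Proof.
move=> hi; have [p [f [_ _ _ _ h]]] := tree_data.
have : nth 0%N (behead D) i.-1 \in behead D.
  by apply: mem_nth; rewrite size_behead; case: i hi => // i; case: (size D).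
rewrite -(perm_mem h) nth_behead prednK; last by case/andP: hi.
by move=> /mapP[j _ ->].
Qed.

(** The child counts add up to [(size D).-1], and every vertex but the root has one further
    neighbour. *)
Lemma degree_sequence_sum : sumn D = (2 * (size D).-1)%N.
Proof.
have [_ T0 _ _] := e_tree.
have [p [f [plt _ _ h0 h]]] := tree_data.
have -> : sumn D = (head 0 D + sumn (behead D))%N by case: (D).
rewrite -h0 -(perm_sumn h) size_degree_sequence sumnE big_map.
under eq_bigr do rewrite -addn1.
rewrite big_split /= sum1_size size_iota addnA.
have := big_partition_kids plt addn (fun=> 1%N).
rewrite (iota_n T0) big_cons /= sum1_size size_iota.
have k1 i : (\sum_(j <- iota 1 #|T|.-1 | p j == i) 1)%N = nkids #|T| p i.
  by rewrite sum1_count.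
rewrite k1; under eq_bigr do rewrite k1.
by move=> ->; rewrite mul2n addnn.
Qed.

Lemma head_degree_sequence_gt0 : (1 < size D)%N -> (0 < nth 0 D 0)%N.
Proof.
move=> h; apply: leq_trans (_ : nth 0%N D 1 <= _)%N; first exact: degree_sequence_gt0.
have := sorted_leq_nth geq_trans (fun a => leqnn a) 0%N degree_sequence_sorted.
by apply; rewrite ?inE //; apply: ltnW.
Qed.

Lemma arities_sorted : sorted leq (arities_of D).
Proof.
rewrite rev_sorted; have := degree_sequence_sorted.
case: (D) => [|d D'] //= h.
apply: (homo_path (e := geq)) => [a b /= ab|]; first by rewrite -!subn1 leq_sub2r.
by apply: subseq_path h; [exact: geq_trans|exact: filter_subseq].
Qed.

(** Applies [huffman_le] to the branches at the root, where every leaf of the initial queue has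
    conductance [1]. *)
Lemma huffman_le_det (R : realFieldType) (x : R) (p : nat -> nat) (f : 'I_#|T| ->
  T) : 0 < x ->
  (forall i, (0 < i < #|T|)%N -> (p i < i)%N) ->
  nkids #|T| p 0 = head 0%N D ->
  perm_eq [seq (nkids #|T| p i).+1 | i <- iota 1 #|T|.-1] (behead D) ->
  huffman x (arities_of D) (nseq (count (pred1 1%N) (behead D)) 1) <=
  \det (\matrix_(i < #|T|, j < #|T|) ((i == j)%:R +
    x * ((degree (pgraph p) i)%:R *+ (i == j) - (pgraph p i j)%:R))).
Proof.
move=> x0 plt h0 h; have [_ T0 _ _] := e_tree.
rewrite (det_rose plt x0 T0) (tree_det_kids0 plt x0 T0).
apply: (huffman_le x0).
- exact: arities_sorted.
- by elim: (count _ _) => //= -[|k] //= ->; rewrite lexx.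
- by rewrite /nneg all_nseq ler01 orbT.
(* The queue invariant holds at the start because [sigma] is at least [1]. *)
- move=> z /nseqP[-> _]; rewrite lerDl big_seq sumr_ge0 // => y /mem_take /nseqP[-> _].
  by apply: cond_ge0.
- rewrite /arities_of /tree_arities perm_sym perm_rev size_kids h0 perm_cons perm_sym.
  apply: perm_trans (all_arities_kids0 plt R T0) _.
  apply: perm_trans (_ : perm_eq _ [seq d.-1 | d <- [seq (nkids #|T| p i).+1 | i <- iota 1
    #|T|.-1] & (1 < d)%N]) _.
    rewrite !filter_map -map_comp.
    rewrite [X in perm_eq _ (map _ X)](eq_filter (a2 := fun i => nkids #|T| p i != 0%N)) =>
      [|i /=]; last by rewrite -lt0n.
    exact: perm_refl.
  by apply/perm_map/perm_filter.
- apply: perm_trans (all_leaves_kids0 plt R T0) _.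
  rewrite -(permP h) count_map; exact: perm_refl.
Qed.

End TreeData.

Theorem corollary2p15 (R : realType) (D : seq nat)
    (hD : exists (T0 : finType) (e0 : rel T0),
        is_tree e0 /\ degree_sequence e0 = D) :
  (is_tree (greedy_tree D) /\ degree_sequence (greedy_tree D) = D) /\
  (forall (T : finType) (e : rel T),
      is_tree e -> degree_sequence e = D ->
      incidence_energy R (greedy_tree D) <= incidence_energy R e /\
      laplacian_energy_like R (greedy_tree D) <= laplacian_energy_like R e).
Proof.
have [T0 [e0 [t0 d0]]] := hD.
have n0 : (0 < size D)%N by rewrite (size_degree_sequence d0); case: t0.
have Ds := degree_sequence_sorted d0.
have Dp := degree_sequence_gt0 t0 d0.
have D0 := head_degree_sequence_gt0 t0 d0.
have DS := degree_sequence_sum t0 d0.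
have glt := greedy_parent_lt n0 Ds Dp D0 DS.
have gE := greedy_treeE n0 Ds Dp D0 DS.
have gt : is_tree (greedy_tree D) by rewrite gE; exact: pgraph_tree.
split; first by split=> //; exact: degree_sequence_greedy.
move=> T e te de.
have [sg [sg0 g1 g2 g3]] := @tree_spectrum R _ (greedy_tree D) (greedy_parent D) (size D) id
  (card_ord _) (fun _ _ => id) glt (fun i j => congr1 (fun g => g i j) gE)
  (let: And4 a _ _ _ := gt in a).
have [p [f [plt fI ef k0 kp]]] := tree_data te de.
have [se [se0 e1 e2 e3]] := @tree_spectrum R _ e p _ f erefl fI plt ef
  (let: And4 a _ _ _ := te in a).
suff le : \sum_(z <- sg) Num.sqrt z <= \sum_(z <- se) Num.sqrt z.
  by rewrite g1 g2 e1 e2.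
(* For each [x] the greedy determinant equals the Huffman value, a lower bound for the determinant
   of any tree with degree sequence [D]. *)
apply: sqrt_sum_le => // x x0; rewrite g3 // e3 //.
rewrite (det_rose glt x0 n0) -(huffman_greedy n0 Ds Dp D0 DS x0).
exact: (huffman_le_det te de f x0 plt k0 kp).
Qed.
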